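(* Let $p=3$ and consider CStrees $\mathcal T$ with levels $(L_1,L_2,L_3)\sim(X_1,X_2,X_3)$. The CStrees that are not staged tree representations of a DAG are precisely those in the following four families. Choose a DAG $G_1$ from the pair $$\{([3],\{1\to2,\,1\to3,\,2\to3\}),\ ([3],\{1\to3,\,2\to3\})\}$$ and a DAG $G_2$ from the pair $$\{(\{1,3\},\emptyset),\ (\{2,3\},\emptyset)\}.$$ Let $i\in\{1,2\}$ be the index that is not a vertex of $G_2$ and let $\emptyset\ne I\subsetneq[d_i]$. The corresponding CStree is the one whose empty context DAG is $G_\emptyset=G_1$ and whose nonempty minimal contexts are exactly $X_i=j$ for $j\in I$, each with minimal context DAG $G_{X_i=j}=G_2$.
   Context: Notation. $[p]=\{1,\dots,p\}$; $X_1,\dots,X_p$ are discrete random variables, $X_i$ with state space $[d_i]=\{1,\dots,d_i\}$. For $A\subseteq[p]$ let $\mathcal R_A=\prod_{i\in A}[d_i]$, $\mathcal R=\mathcal R_{[p]}$. For $\mathbf x\in\mathcal R_B$ and $A\subseteq B$, $\mathbf x_A=(x_i)_{i\in A}$; for disjoint $A,B$, $\mathbf x_A\mathbf x_B\in\mathcal R_{A\cup B}$ is the combined outcome. CStrees. Let $\mathcal T=(V,E)$ be the rooted tree with $V=\{\mathrm{root}\}\cup\bigcup_{j\in[p]}\mathcal R_{[j]}$ and edges $\mathrm{root}\to x_1$ and $x_1\cdots x_{k-1}\to x_1\cdots x_k$. Its $k$-th level is $L_k=\mathcal R_{[k]}$ ($L_0=\{\mathrm{root}\}$), associated with $X_k$;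 $E(v)$ is the set of outgoing edges of $v$. A labeling $\theta:E\to\mathcal L$ ($\mathcal L$ a finite set) makes $\mathcal T$ a staged tree if $|\theta(E(v))|=|E(v)|$ for all $v$, and $\theta(E(v)),\theta(E(w))$ are equal or disjoint for all $v,w$. Non-leaf vertices $v,w$ are in the same stage iff $\theta(E(v))=\theta(E(w))$; the equivalence classes are the stages (leaves are regarded as singleton stages). A staged tree is a CStree if: (1) $\theta(E(v))\ne\theta(E(w))$ for non-leaf $v,w$ in different levels; (2) $\theta(x_1\cdots x_{k-1}\to x_1\cdots x_{k-1}x_k)=\theta(y_1\cdots y_{k-1}\to y_1\cdots y_{k-1}x_k)$ whenever $x_1\cdots x_{k-1}$ and $y_1\cdots y_{k-1}$ are in the same stage; (3) for every $k\in[p]$ and every stage $S\subseteq L_{k-1}$ there are $C\subseteq[k-1]$ and $\mathbf x_C\in\mathcal R_C$ with $S=\{\mathbf x_C\mathbf y:\mathbf y\in\mathcal R_{[k-1]\setminus C}\}$. CStrees are considered up to renaming of labels, i.e. they are determined by their stages. DAG representation. For a DAG $G$ on $[p]$ with all edges $i\to j$ satisfying $i<j$, $\mathcal T_G$ is the CStree whose stages in level $L_{k-1}$ are the sets $\{\mathbf x_{\mathrm{pa}(k)}\mathbf y:\mathbf y\in\mathcal R_{[k-1]\setminus\mathrm{pa}(k)}\}$, one for each $\mathbf x_{\mathrm{pa}(k)}\in\mathcal R_{\mathrm{pa}(k)}$ ($k\in[p]$). $\mathcal T$ is a staged tree representation of a DAG if $\mathcal T=\mathcal T_G$ for some such $G$.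 CSI statements and $\mathcal J(\mathcal T)$. A CSI statement is written $X_A\perp X_B\mid X_S,X_C=\mathbf x_C$ with $A,B,S,C\subseteq[p]$ pairwise disjoint and $\mathbf x_C\in\mathcal R_C$ (trivial if $A$ or $B$ is empty); if $C=\emptyset$ it is a CI statement. For a stage $S\subseteq L_{k-1}$ let $C\subseteq[k-1]$ be the set of indices at which all elements of $S$ agree and $\mathbf x_C$ the common value; the stage statement is $X_k\perp X_{[k-1]\setminus C}\mid X_C=\mathbf x_C$. $\mathcal J(\mathcal T)$ is the set of all CSI statements derivable from the stage statements by the CSI axioms (all index sets disjoint; $A\perp B|S,\mathbf x_C$ abbreviates $X_A\perp X_B|X_S,X_C=\mathbf x_C$): symmetry: $A\perp B|S,\mathbf x_C\Rightarrow B\perp A|S,\mathbf x_C$; decomposition: $A\perp B\cup D|S,\mathbf x_C\Rightarrow A\perp B|S,\mathbf x_C$; weak union: $A\perp B\cup D|S,\mathbf x_C\Rightarrow A\perp B|S\cup D,\mathbf x_C$; contraction: $A\perp B|S\cup D,\mathbf x_C$ and $A\perp D|S,\mathbf x_C\Rightarrow A\perp B\cup D|S,\mathbf x_C$; intersection: $A\perp B|S\cup D,\mathbf x_C$ and $A\perp S|B\cup D,\mathbf x_C\Rightarrow A\perp B\cup S|D,\mathbf x_C$; specialization: $A\perp B|S,\mathbf x_C$, $T\subseteq S$, $\mathbf x_T\in\mathcal R_T\Rightarrow A\perp B|S\setminus T,\mathbf x_{T\cup C}$; absorption: if for some $T\subseteq C$ one has $A\perp B|S,\mathbf x_{C\setminus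 T}\mathbf x_T$ for all $\mathbf x_T\in\mathcal R_T$, then $A\perp B|S\cup T,\mathbf x_{C\setminus T}$. Minimal contexts. $X_C=\mathbf x_C$ ($C$ possibly empty) is a minimal context of $\mathcal T$ if there is a statement $X_A\perp X_B|X_S,X_C=\mathbf x_C$ in $\mathcal J(\mathcal T)$ with $A,B\neq\emptyset$ such that for no nonempty $T\subseteq C$ is $X_A\perp X_B|X_{S\cup T},X_{C\setminus T}=\mathbf x_{C\setminus T}$ in $\mathcal J(\mathcal T)$. Let $\mathcal J(X_C=\mathbf x_C)$ be the set of CI statements $X_A\perp X_B|X_S$ with $A,B,S\subseteq[p]\setminus C$ and $X_A\perp X_B|X_S,X_C=\mathbf x_C\in\mathcal J(\mathcal T)$. The minimal context DAG $G_{X_C=\mathbf x_C}$ is the DAG on $[p]\setminus C$, with all edges $i\to j$ satisfying $i<j$, that is a minimal I-MAP of $\mathcal J(X_C=\mathbf x_C)$: all its d-separation statements lie in $\mathcal J(X_C=\mathbf x_C)$, and this fails after removing any edge. If the empty context is not a minimal context, $G_\emptyset$ denotes the complete DAG on $[p]$ (all edges $i\to j$, $i<j$).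
   Formalization: Existence of the corresponding CStree is claimed only for d_1, d_2 ≥ 2: if d_1 or d_2 equals 1, every CStree represents a DAG, so no CStree corresponds to an allowed I (e.g. d_2 = 1, d_1 = 2, i = 1, I = {1}). Classification and uniqueness are for all d_i ≥ 1. *)

(* Defs.v *)
(* Based on Mathematical Components. Indices are 0-based: the k-th variable (k : 'I_p) is the
   paper's X_{k+1}, and its state space [d_{k+1}] is 'I_(d k). *)
From HB Require Import structures.
From mathcomp Require Import all_boot.

Set Implicit Arguments.
Unset Strict Implicit.
Unset Printing Implicit Defensive.

(** Outcomes *)

(* The elements of all the R_A, A \subset [p], live in one type of partial
   assignments; R_A consists of the assignments with domain exactly A, and
   the empty assignment is the unique element of R_{} (the root). *)
Definition outcome p (d : 'I_p -> nat) : finType :=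
  {dffun forall i : 'I_p, option 'I_(d i)}.

Definition dom p (d : 'I_p -> nat) (x : outcome d) : {set 'I_p} :=
  [set i | isSome (x i)].

Definition outcomes p (d : 'I_p -> nat) (A : {set 'I_p}) : {set outcome d} :=
  [set x | dom x == A].

Definition restr p (d : 'I_p -> nat) (A : {set 'I_p}) (x : outcome d) :
    outcome d :=
  [ffun i => if i \in A then x i else None].

(* The combined outcome x_A x_B; only used when dom x and dom y are
   disjoint. *)
Definition join p (d : 'I_p -> nat) (x y : outcome d) : outcome d :=
  [ffun i => if x i is Some a then Some a else y i].

Definition no_context p (d : 'I_p -> nat) : outcome d := [ffun i => None].

(** The tree *)

Definition below p (k : nat) : {set 'I_p} := [set i : 'I_p | i < k].

Definition level p (d : 'I_p -> nat) (k : nat) : {set outcome d} :=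
  outcomes d (below p k).

Definition vertices p (d : 'I_p -> nat) : {set outcome d} :=
  \bigcup_(k < p.+1) level d k.

Definition leaf p (d : 'I_p -> nat) (v : outcome d) : bool := v \in level d p.

Definition edge p (d : 'I_p -> nat) (v w : outcome d) : bool :=
  [exists k : 'I_p,
    [&& v \in level d k, w \in level d k.+1 & restr (below p k) w == v]].

Definition children p (d : 'I_p -> nat) (v : outcome d) : {set outcome d} :=
  [set w | edge v w].

(** Staged trees and CStrees.
    A labeling is a function of the two end points; only its values on pairs
    (v, w) with edge v w are ever used. *)

Definition edge_labels p (d : 'I_p -> nat) (L : finType)
    (theta : outcome d -> outcome d -> L) (v : outcome d) : {set L} :=
  [set theta v w | w in children v].

Definition staged_tree p (d : 'I_p -> nat) (L : finType)
    (theta : outcome d -> outcome d -> L) : Prop :=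
  (forall v, v \in vertices d -> #|edge_labels theta v| = #|children v|) /\
  (forall v w, v \in vertices d -> w \in vertices d ->
     edge_labels theta v = edge_labels theta w \/
     [disjoint edge_labels theta v & edge_labels theta w]).

Definition same_stage p (d : 'I_p -> nat) (L : finType)
    (theta : outcome d -> outcome d -> L) (v w : outcome d) : bool :=
  if leaf v || leaf w then v == w
  else edge_labels theta v == edge_labels theta w.

Definition label_stages p (d : 'I_p -> nat) (L : finType)
    (theta : outcome d -> outcome d -> L) : {set {set outcome d}} :=
  [set [set w in vertices d | same_stage theta v w] | v in vertices d].

Definition cylinder p (d : 'I_p -> nat) (k : nat) (x : outcome d) :
    {set outcome d} :=
  [set join x y | y in outcomes d (below p k :\: dom x)].

Record cstree p (d : 'I_p -> nat) := CStree {
  label : finType;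
  theta : outcome d -> outcome d -> label;
  cstree_staged : staged_tree theta;
  cstree_levels : forall (k l : 'I_p) v w,
    v \in level d k -> w \in level d l -> k != l ->
    edge_labels theta v <> edge_labels theta w;
  cstree_labels : forall (k : 'I_p) v v' w w',
    v \in level d k -> v' \in level d k -> same_stage theta v v' ->
    edge v w -> edge v' w' -> w k = w' k -> theta v w = theta v' w';
  cstree_contexts : forall (k : 'I_p) (S : {set outcome d}),
    S \in label_stages theta -> S \subset level d k ->
    exists (C : {set 'I_p}) (x : outcome d),
      [/\ C \subset below p k, x \in outcomes d C & S = cylinder k x] }.

Definition stages p (d : 'I_p -> nat) (T : cstree d) : {set {set outcome d}} :=
  label_stages (@theta p d T).

Definition stages_at p (d : 'I_p -> nat) (T : cstree d) (k : nat) :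
    {set {set outcome d}} :=
  [set S in stages T | S \subset level d k].

(* Equality of CStrees, which are considered up to renaming of labels. *)
Definition cstree_eq p (d : 'I_p -> nat) (T T' : cstree d) : Prop :=
  stages T = stages T'.

(** DAGs on a subset of [p] *)

Record digraph p := Digraph {
  vset : {set 'I_p};
  eset : {set 'I_p * 'I_p} }.

(* Acyclicity follows from the edges being increasing. *)
Definition ordered_dag p (G : digraph p) : Prop :=
  forall i j, (i, j) \in eset G -> [/\ i \in vset G, j \in vset G & i < j].

Definition parents p (G : digraph p) (k : 'I_p) : {set 'I_p} :=
  [set i | (i, k) \in eset G].

Definition remove_edge p (G : digraph p) (e : 'I_p * 'I_p) : digraph p :=
  Digraph (vset G) (eset G :\ e).

Definition complete_dag p : digraph p :=
  Digraph [set: 'I_p] [set e : 'I_p * 'I_p | e.1 < e.2].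

Definition represents_dag p (d : 'I_p -> nat) (T : cstree d) (G : digraph p) :
    Prop :=
  forall k : 'I_p,
    stages_at T k = [set cylinder k x | x in outcomes d (parents G k)].

Definition dag_representation p (d : 'I_p -> nat) (T : cstree d) : Prop :=
  exists G : digraph p,
    [/\ vset G = [set: 'I_p], ordered_dag G & represents_dag T G].

(** d-separation *)

Definition adjacent p (G : digraph p) : rel 'I_p :=
  fun i j => ((i, j) \in eset G) || ((j, i) \in eset G).

Definition descendant p (G : digraph p) : rel 'I_p :=
  connect (fun i j => (i, j) \in eset G).

(* Whether y does not block a path ... x - y - z ... given S. *)
Definition open_at p (G : digraph p) (S : {set 'I_p}) (x y z : 'I_p) : bool :=
  if ((x, y) \in eset G) && ((z, y) \in eset G)
  then [exists w in S, descendant G y w]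
  else y \notin S.

(* Whether no inner vertex of the path x :: s blocks it given S. *)
Fixpoint open_path p (G : digraph p) (S : {set 'I_p}) (x : 'I_p)
    (s : seq 'I_p) : bool :=
  if s is y :: s' then
    (if s' is z :: _ then open_at G S x y z else true) && open_path G S y s'
  else true.

Definition d_separated p (G : digraph p) (A B S : {set 'I_p}) : Prop :=
  forall (a b : 'I_p) (s : seq 'I_p), a \in A -> b \in B ->
    path (adjacent G) a s -> uniq (a :: s) -> last a s = b ->
    ~~ open_path G S a s.

(** CSI statements *)

Definition pairwise_disjoint p (As : seq {set 'I_p}) : bool :=
  pairwise (fun A B : {set 'I_p} => [disjoint A & B]) As.

Definition agreement p (d : 'I_p -> nat) (k : nat) (S : {set outcome d}) :
    {set 'I_p} :=
  [set i in below p k | [forall v in S, forall w in S, v i == w i]].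

(* csi T A B S c: the statement X_A _||_ X_B | X_S, X_C = x_C is in J(T),
   where the context c is x_C and C = dom c. *)
Inductive csi p (d : 'I_p -> nat) (T : cstree d) :
    {set 'I_p} -> {set 'I_p} -> {set 'I_p} -> outcome d -> Prop :=
| csi_stage (k : 'I_p) (S : {set outcome d}) (v : outcome d) :
    S \in stages_at T k -> v \in S ->
    csi T [set k] (below p k :\: agreement k S) set0 (restr (agreement k S) v)
| csi_symmetry (A B S : {set 'I_p}) (c : outcome d) :
    csi T A B S c -> csi T B A S c
| csi_decomposition (A B D S : {set 'I_p}) (c : outcome d) :
    pairwise_disjoint [:: A; B; D; S; dom c] ->
    csi T A (B :|: D) S c -> csi T A B S c
| csi_weak_union (A B D S : {set 'I_p}) (c : outcome d) :
    pairwise_disjoint [:: A; B; D; S; dom c] ->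
    csi T A (B :|: D) S c -> csi T A B (S :|: D) c
| csi_contraction (A B D S : {set 'I_p}) (c : outcome d) :
    pairwise_disjoint [:: A; B; D; S; dom c] ->
    csi T A B (S :|: D) c -> csi T A D S c -> csi T A (B :|: D) S c
| csi_intersection (A B D S : {set 'I_p}) (c : outcome d) :
    pairwise_disjoint [:: A; B; D; S; dom c] ->
    csi T A B (S :|: D) c -> csi T A S (B :|: D) c -> csi T A (B :|: S) D c
| csi_specialization (A B S U : {set 'I_p}) (c x : outcome d) :
    U \subset S -> x \in outcomes d U ->
    csi T A B S c -> csi T A B (S :\: U) (join c x)
(* Here c is x_{C \ U}, so that C is the disjoint union of dom c and U. *)
| csi_absorption (A B S U : {set 'I_p}) (c : outcome d) :
    pairwise_disjoint [:: A; B; S; U; dom c] ->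
    (forall x, x \in outcomes d U -> csi T A B S (join c x)) ->
    csi T A B (S :|: U) c.

(** Minimal contexts *)

Definition minimal_context p (d : 'I_p -> nat) (T : cstree d) (c : outcome d) :
    Prop :=
  exists A B S : {set 'I_p},
    [/\ A != set0, B != set0, csi T A B S c &
        forall U : {set 'I_p}, U != set0 -> U \subset dom c ->
          ~ csi T A B (S :|: U) (restr (~: U) c)].

Definition context_ci p (d : 'I_p -> nat) (T : cstree d) (c : outcome d)
    (A B S : {set 'I_p}) : Prop :=
  [/\ A \subset ~: dom c, B \subset ~: dom c, S \subset ~: dom c &
      csi T A B S c].

(* Only nontrivial statements are tested: J(T) need not contain every trivial
   one. *)
Definition imap p (J : {set 'I_p} -> {set 'I_p} -> {set 'I_p} -> Prop)
    (G : digraph p) : Prop :=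
  forall A B S : {set 'I_p},
    A \subset vset G -> B \subset vset G -> S \subset vset G ->
    pairwise_disjoint [:: A; B; S] -> A != set0 -> B != set0 ->
    d_separated G A B S -> J A B S.

Definition minimal_imap p (J : {set 'I_p} -> {set 'I_p} -> {set 'I_p} -> Prop)
    (G : digraph p) : Prop :=
  imap J G /\ forall e, e \in eset G -> ~ imap J (remove_edge G e).

Definition minimal_context_dag p (d : 'I_p -> nat) (T : cstree d)
    (c : outcome d) (G : digraph p) : Prop :=
  [/\ vset G = ~: dom c, ordered_dag G & minimal_imap (context_ci T c) G].

Definition empty_context_dag p (d : 'I_p -> nat) (T : cstree d)
    (G : digraph p) : Prop :=
  (minimal_context T (no_context d) ->
     minimal_context_dag T (no_context d) G) /\
  (~ minimal_context T (no_context d) -> G = complete_dag p).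

(** The four families for p = 3 *)

Definition X1 : 'I_3 := @Ordinal 3 0 isT.
Definition X2 : 'I_3 := @Ordinal 3 1 isT.
Definition X3 : 'I_3 := @Ordinal 3 2 isT.

Definition family_choice (d : 'I_3 -> nat) (G1 G2 : digraph 3) (i : 'I_3)
    (I : {set 'I_(d i)}) : Prop :=
  [/\ G1 = Digraph [set: 'I_3] [set (X1, X2); (X1, X3); (X2, X3)] \/
      G1 = Digraph [set: 'I_3] [set (X1, X3); (X2, X3)],
      G2 = Digraph [set X1; X3] set0 \/ G2 = Digraph [set X2; X3] set0,
      i \in [set X1; X2] /\ i \notin vset G2 &
      I != set0 /\ I \proper [set: 'I_(d i)]].

Definition is_corresponding (d : 'I_3 -> nat) (T : cstree d)
    (G1 G2 : digraph 3) (i : 'I_3) (I : {set 'I_(d i)}) : Prop :=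
  [/\ empty_context_dag T G1,
      forall c : outcome d, dom c != set0 ->
        (minimal_context T c <->
         exists2 j, j \in I & c \in outcomes d [set i] /\ c i = Some j) &
      forall (c : outcome d) j, j \in I -> c \in outcomes d [set i] ->
        c i = Some j -> minimal_context_dag T c G2].

(* Main.v *)
(* For p = 3 the stages in the third level partition [d_1] x [d_2] into the
   whole grid, rows, columns and points.  A row and a column always meet, so
   proper rows and proper columns cannot both occur: the tree is either that of
   a DAG or it merges exactly the lines X_i = j, j in a nonempty proper subset I,
   for one i in {1, 2}, the second level being one stage or fully split.

   Derivability is controlled without any probabilistic model.  For a tree of
   the second kind the stage statements with nonempty sides, X_3 _||_ X_i' | X_i = j
   for j in I and possibly X_1 _||_ X_2, are up to symmetry already closed
   under the CSI axioms: their conditioning set is empty and their sides are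
   singletons, and absorption of X_i would need all j in [d_i].  For a DAG, J(T)
   does not depend on the values in the contexts, so that every context can be
   absorbed. *)
Require Import Defs.
From HB Require Import structures.
From mathcomp Require Import all_boot.

Set Implicit Arguments.
Unset Strict Implicit.
Unset Printing Implicit Defensive.

(** * Outcomes *)

Section Outcomes.
Variables (p : nat) (d : 'I_p -> nat).
Implicit Types (v w x y c : outcome d) (A B S : {set 'I_p}).

Lemma in_dom x i : (i \in dom x) = isSome (x i). Proof. by rewrite inE. Qed.

Lemma notin_dom x i : i \notin dom x -> x i = None.
Proof. by rewrite inE; case: (x i). Qed.

Lemma restrE A x i : restr A x i = if i \in A then x i else None.
Proof. by rewrite ffunE. Qed.

Lemma joinE x y i : join x y i = if x i is Some a then Some a else y i.
Proof. by rewrite ffunE. Qed.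

Lemma dom_restr A x : dom (restr A x) = A :&: dom x.
Proof. by apply/setP => i; rewrite !inE restrE; case: (i \in A). Qed.

Lemma dom_join x y : dom (join x y) = dom x :|: dom y.
Proof. by apply/setP => i; rewrite !inE joinE; case: (x i). Qed.

Lemma dom_no_context : dom (no_context d) = set0.
Proof. by apply/setP => i; rewrite !inE ffunE. Qed.

Lemma dom_eq0 x : dom x = set0 -> x = no_context d.
Proof.
by move=> x0; apply/ffunP => i; rewrite ffunE notin_dom // x0 inE.
Qed.

Lemma join_no_context x : join x (no_context d) = x.
Proof. by apply/ffunP => i; rewrite joinE ffunE; case: (x i). Qed.

Lemma restr_eqP A x y :
  reflect (forall i, i \in A -> x i = y i) (restr A x == restr A y).
Proof.
apply: (iffP eqP) => [xy i Ai|xy].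
  by move/ffunP: xy => /(_ i); rewrite !restrE Ai.
by apply/ffunP => i; rewrite !restrE; case: ifP => // /xy.
Qed.

Lemma restr_dom A x : dom x \subset A -> restr A x = x.
Proof.
move=> /subsetP sxA; apply/ffunP => i; rewrite restrE; case: ifP => // /negbT.
by move=> iA; rewrite notin_dom //; apply: contra iA => /sxA.
Qed.

Lemma outcome_eqP A x y : dom x = A -> dom y = A ->
  (forall i, i \in A -> x i = y i) -> x = y.
Proof.
move=> xA yA /restr_eqP /eqP.
by rewrite !restr_dom ?xA ?yA.
Qed.

Lemma in_level k v : (v \in level d k) = (dom v == below p k).
Proof. by rewrite inE. Qed.

Lemma level_dom k v : v \in level d k -> dom v = below p k.
Proof. by rewrite in_level => /eqP. Qed.

Lemma in_below k i : (i \in below p k) = (i < k). Proof. by rewrite inE. Qed.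

(** Beyond [p] the sets [below p k] no longer grow, whence the bounds; the smaller index lies in
    exactly one of the two sets. *)
Lemma below_inj k l : k <= p -> l <= p -> below p k = below p l -> k = l.
Proof.
have aux m n : m < n -> n <= p -> below p m <> below p n.
  move=> mn np /setP /(_ (Ordinal (leq_trans mn np))).
  by rewrite !in_below /= ltnn mn.
move=> kp lp kl; case: (ltngtP k l) => // [/aux /(_ lp)|/aux /(_ kp)] //.
by rewrite kl.
Qed.

(** Trades the existential over completions for a membership test; the completion is recovered by
    restricting [v] outside [dom x]. *)
Lemma cylinderE k x v : dom x \subset below p k ->
  (v \in cylinder k x) = (v \in level d k) && (restr (dom x) v == x).
Proof.
move=> xk; apply/imsetP/andP => [[y]|[vk /eqP vx]].
  rewrite inE => /eqP yE ->; rewrite in_level dom_join yE; split.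
    apply/eqP/setP => i; have := subsetP xk i.
    by rewrite in_dom !inE; case: (x i) => [a -> //|_].
  apply/eqP/ffunP => i; rewrite restrE joinE in_dom.
  by case: (x i).
exists (restr (below p k :\: dom x) v).
  rewrite inE dom_restr (level_dom vk); apply/eqP/setIidPl.
  exact: subsetDl.
apply/ffunP => i; rewrite joinE restrE !inE.
have := congr1 (fun x : outcome d => x i) vx; rewrite restrE in_dom.
case: (x i) => [a //|_] /=; case: ltnP => // ik.
by rewrite notin_dom // (level_dom vk) inE -leqNgt.
Qed.

Lemma level_vertices k v : k <= p -> v \in level d k -> v \in vertices d.
Proof. by move=> kp vk; apply/bigcupP; exists (inord k); rewrite ?inordK. Qed.

Lemma level_nleaf (k : 'I_p) v : v \in level d k -> leaf v = false.
Proof.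
rewrite /leaf !in_level => /eqP ->; apply/negP => /eqP.
move/(below_inj (ltnW (ltn_ord k)) (leqnn p)) => E.
by have := ltn_ord k; rewrite E ltnn.
Qed.

Lemma verticesP v : v \in vertices d -> leaf v \/ exists k : 'I_p, v \in level d k.
Proof.
case/bigcupP => k _ vk; case: (ltnP k p) => kp.
  by right; exists (Ordinal kp).
have kE : k = p :> nat by apply/eqP; rewrite eqn_leq kp -ltnS ltn_ord.
by left; rewrite /leaf in_level (level_dom vk) kE.
Qed.

Lemma same_stageE (L : finType) (th : outcome d -> outcome d -> L)
    (k l : 'I_p) v w : v \in level d k -> w \in level d l ->
  same_stage th v w = (edge_labels th v == edge_labels th w).
Proof. by move=> vk wl; rewrite /same_stage !(level_nleaf vk, level_nleaf wl). Qed.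

(** * Outcomes over nonempty state spaces *)

Hypothesis d_gt0 : forall i, 0 < d i.

Lemma outcomes_nonempty A : exists x, x \in outcomes d A.
Proof.
exists [ffun i => if i \in A then Some (Ordinal (d_gt0 i)) else None].
by rewrite inE; apply/eqP/setP => i; rewrite inE ffunE; case: ifP.
Qed.

Lemma extend_level k x : dom x \subset below p k ->
  exists2 v, v \in level d k & restr (dom x) v = x.
Proof.
move=> xk; have [y] := outcomes_nonempty (below p k :\: dom x).
move=> yk; exists (join x y).
  have: join x y \in cylinder k x by apply: imset_f.
  by rewrite cylinderE // => /andP[].
have: join x y \in cylinder k x by apply: imset_f.
by rewrite cylinderE // => /andP[_ /eqP].
Qed.

Lemma single_outcome i (j : 'I_(d i)) :
  exists2 c, c \in outcomes d [set i] & c i = Some j.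
Proof.
(* [dfwith] is the dependent update at [i], since the type of [j] depends on [i]. *)
exists [ffun k => @dfwith _ (fun k => option 'I_(d k)) (fun=> None) i (Some j) k].
  rewrite inE; apply/eqP/setP => k; rewrite !inE ffunE.
  by case: (eqVneq k i) => [->|ki]; rewrite ?dfwith_in // dfwith_out // eq_sym.
by rewrite ffunE dfwith_in.
Qed.

(** The context read off a stage can exceed the one defining it, as a variable with one value always
    agrees. It depends on [x] only through its domain, on which [csi_dag_context] relies. *)
Lemma agreement_cylinder k x : dom x \subset below p k ->
  agreement k (cylinder k x) = [set i in below p k | (i \in dom x) || (d i == 1)].
Proof.
move=> xk; apply/setP => i; rewrite !inE; case: (ltnP i k) => //= ik.
apply/idP/idP => [agr|].
  case xi: (x i) => [//|] /=.
  rewrite eqn_leq d_gt0 andbT leqNgt; apply/negP => di1.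
  (* A free variable with two values takes both inside the cylinder, against the agreement. *)
  have val j : exists2 v, v \in cylinder k x & v i = Some j.
    have [y] := single_outcome j; rewrite inE => /eqP yE yj.
    have xyk : dom (join x y) \subset below p k.
      by rewrite dom_join subUset xk yE sub1set in_below ik.
    have [v vk vE] := extend_level xyk; exists v.
      rewrite cylinderE // vk /=; apply/eqP/ffunP => l.
      rewrite restrE; move/ffunP: vE => /(_ l).
      rewrite restrE dom_join !inE joinE.
      by case: (x l) => [a //|]; rewrite ?orbF.
    move/ffunP: vE => /(_ i); rewrite restrE dom_join yE !inE eqxx orbT.
    by rewrite joinE xi yj.
  have [v vk vj] := val (Ordinal (d_gt0 i)).
  have [w wk wj] := val (Ordinal di1).
  by move/forall_inP: agr => /(_ _ vk) /forall_inP /(_ _ wk); rewrite vj wj.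
move=> H; apply/forall_inP => v; rewrite cylinderE // => /andP[vk /eqP vx].
apply/forall_inP => w; rewrite cylinderE // => /andP[wk /eqP wx].
case/orP: H => [xi|/eqP di].
  have xE u : restr (dom x) u = x -> u i = x i.
    by move/(congr1 (fun y : outcome d => y i)); rewrite restrE in_dom xi.
  by rewrite !xE.
have [iv iw] : i \in dom v /\ i \in dom w by rewrite (level_dom vk) (level_dom wk) inE.
move: iv iw; rewrite !in_dom; case: (v i) (w i) => [a|] // [b|] // _ _.
apply/eqP; congr Some; apply/val_inj.
have val0 (e : 'I_(d i)) : e = 0 :> nat.
  by apply/eqP; rewrite -leqn0 -ltnS (leq_trans (ltn_ord e)) ?di.
by rewrite /= !val0.
Qed.

End Outcomes.

(** * Stages and CSI statements *)

Section CStrees.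
Variables (p : nat) (d : 'I_p -> nat).
Implicit Types (T : cstree d) (v w x c : outcome d) (A B S : {set 'I_p}).

Lemma same_stage_refl (L : finType) (th : outcome d -> outcome d -> L) v :
  same_stage th v v.
Proof. by rewrite /same_stage !eqxx if_same. Qed.

(** Condition (1) of CStrees separates the non-leaf levels, and a leaf is alone in its stage. *)
Lemma same_stage_level T (k : 'I_p) v w : v \in level d k ->
  w \in vertices d -> same_stage (@theta _ _ T) v w -> w \in level d k.
Proof.
move=> vk /verticesP[wl|[l wl]].
  by rewrite /same_stage wl orbT => /eqP <-.
rewrite (same_stageE _ vk wl) => /eqP vw.
case: (eqVneq k l) => [-> //|kl].
by case: (cstree_levels vk wl kl vw).
Qed.

(** For [v] in level [k] this is the full stage of [v], since stages do not leave their level. *)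
Definition stage T (k : nat) v : {set outcome d} :=
  [set w in level d k | same_stage (@theta _ _ T) v w].

Lemma stages_atP T (k : 'I_p) (X : {set outcome d}) :
  reflect (exists2 v, v \in level d k & X = stage T k v) (X \in stages_at T k).
Proof.
have kp : k <= p by apply: ltnW.
have stE v : v \in level d k ->
    [set w in vertices d | same_stage (@theta _ _ T) v w] = stage T k v.
  move=> vk; apply/setP => w; rewrite !inE -/(w \in level d k) -in_level.
  apply/andP/andP => -[wV vw]; split=> //.
    exact: same_stage_level vk wV vw.
  exact: level_vertices wV.
rewrite inE; apply: (iffP andP) => [[/imsetP[v vV ->] Xk]|[v vk ->]].
  have vk : v \in level d k by apply: (subsetP Xk); rewrite inE vV same_stage_refl.
  by exists v; rewrite // stE.
split; last by apply/subsetP => w; rewrite inE => /andP[].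
by apply/imsetP; exists v; rewrite ?stE //; apply: level_vertices vk.
Qed.

(** Leaves are singleton stages in both trees and no stage crosses levels. *)
Lemma cstree_eq_levelwise T T' :
  (forall (k : 'I_p) v w, v \in level d k -> w \in level d k ->
     same_stage (@theta _ _ T) v w = same_stage (@theta _ _ T') v w) ->
  cstree_eq T T'.
Proof.
move=> TT'; apply: eq_in_imset => v vV; apply/setP => w; rewrite !inE.
apply: andb_id2l => wV.
have [vl|[k vk]] := verticesP vV; first by rewrite /same_stage vl.
case: (boolP (w \in level d k)) => [wk|wk]; first exact: TT' vk wk.
transitivity false; last apply/esym; apply/negbTE; apply: contra wk;
  exact: same_stage_level.
Qed.

(** Condition (3) as a test on two vertices; [C] may vary with [v], which is where a CStree differs
    from a DAG. *)
Lemma stage_context T (k : 'I_p) v : v \in level d k ->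
  exists2 C : {set 'I_p}, C \subset below p k &
    forall w, w \in level d k ->
      same_stage (@theta _ _ T) v w = (restr C v == restr C w).
Proof.
move=> vk; have : stage T k v \in stages_at T k by apply/stages_atP; exists v.
rewrite inE => /andP[/cstree_contexts] /[apply] -[C [x [Ck]]].
rewrite inE => /eqP xC /setP stE; exists C => // w wk.
have mem u : u \in level d k ->
    same_stage (@theta _ _ T) v u = (restr C u == x).
  by move=> uk; have := stE u; rewrite inE uk cylinderE xC // uk.
by rewrite mem // eq_sym; have := mem v vk; rewrite same_stage_refl => /esym /eqP ->.
Qed.

(** Counting memberships pointwise reduces disjointness goals to Boolean case analysis. *)
Lemma pairwise_disjointP (As : seq {set 'I_p}) :
  reflect (forall i, count (fun A : {set 'I_p} => i \in A) As <= 1)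
          (pairwise_disjoint As).
Proof.
elim: As => [|A As IH] /=; first by apply: ReflectT.
rewrite -/(pairwise_disjoint As); apply: (iffP andP) => [[AAs /IH As1] i|H].
  case: (boolP (i \in A)) => iA; last by rewrite add0n.
  rewrite add1n ltnS leqNgt -has_count; apply/hasPn => B /(allP AAs) /= AB.
  by rewrite (disjointFr AB iA).
split; last by apply/IH => i; apply: leq_trans (H i); apply: leq_addl.
apply/allP => B BAs; rewrite disjoint_subset; apply/subsetP => i iA.
have := H i; rewrite iA add1n ltnS leqNgt -has_count.
by move/hasPn => /(_ _ BAs).
Qed.

Lemma agreement_sub k (X : {set outcome d}) : agreement k X \subset below p k.
Proof. by apply/subsetP => i; rewrite inE => /andP[]. Qed.

Lemma dom_restr_agreement k (X : {set outcome d}) v : v \in level d k ->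
  dom (restr (agreement k X) v) = agreement k X.
Proof.
by move=> /level_dom vk; rewrite dom_restr vk; apply/setIidPl/agreement_sub.
Qed.

(** Not every rule of [csi] asks for disjoint sets, but stage statements have them and each rule
    keeps them; specialization only moves [U] from [S] to the context. *)
Lemma csi_disjoint T A B S c : csi T A B S c ->
  pairwise_disjoint [:: A; B; S; dom c].
Proof.
elim=> {A B S c} [k X v XT vX|A B S c _ H|A B D S c _ _ H|A B D S c dis _ H
    |A B D S c + _ _ _ _|A B D S c + _ _ _ _|A B S U c x /subsetP US + _ H
    |A B S U c + _ _].
- have vk : v \in level d k by move: XT; rewrite inE => /andP[_ /subsetP]; apply.
  apply/pairwise_disjointP => i; rewrite dom_restr_agreement //.
  have := subsetP (agreement_sub k X) i.
  rewrite /= !in_set1 in_setD !in_below in_set0; case: (i \in agreement k X).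
    by move/(_ isT); case: eqP => [->|]; rewrite ?ltnn.
  by case: eqP => [->|]; rewrite ?ltnn //; case: (i < k).
- move/pairwise_disjointP: H => H; apply/pairwise_disjointP => i; move: (H i) => /=.
  by do 4 case: (_ \in _).
- move/pairwise_disjointP: H => H; apply/pairwise_disjointP => i; move: (H i) => /=.
  by rewrite !in_setU; do 5 case: (_ \in _).
- move/pairwise_disjointP: dis => dis.
  move/pairwise_disjointP: H => H; apply/pairwise_disjointP => i; move: (H i) => /=.
  by move: (dis i); rewrite /= !in_setU; do 5 case: (_ \in _).
- move/pairwise_disjointP => H; apply/pairwise_disjointP => i; move: (H i) => /=.
  by rewrite !in_setU; do 5 case: (_ \in _).
- move/pairwise_disjointP => H; apply/pairwise_disjointP => i; move: (H i) => /=.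
  by rewrite !in_setU; do 5 case: (_ \in _).
- rewrite inE => /eqP xU; move/pairwise_disjointP: H => H.
  apply/pairwise_disjointP => i; move: (H i) (US i) => /=.
  rewrite dom_join xU in_setU in_setD.
  by do 5 case: (_ \in _) => //; move=> _ /(_ isT).
- move/pairwise_disjointP => H; apply/pairwise_disjointP => i; move: (H i) => /=.
  by rewrite !in_setU; do 5 case: (_ \in _).
Qed.

(** * Trees of DAGs *)

Hypothesis d_gt0 : forall i, 0 < d i.

(** A context set [P] that serves a whole level [k] becomes the parent set of [k]; the edges
    increase because [P] lies below [k]. *)
Lemma dag_of_parents T :
  (forall k : 'I_p, exists2 P : {set 'I_p}, P \subset below p k &
     forall v w, v \in level d k -> w \in level d k ->
       same_stage (@theta _ _ T) v w = (restr P v == restr P w)) ->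
  dag_representation T.
Proof.
case/fin_all_exists2 => P Pk TP.
exists (Digraph [set: 'I_p] [set e | e.1 \in P e.2]); split=> //.
  by move=> i j; rewrite !inE => /(subsetP (Pk j)); rewrite inE.
move=> k; have -> : parents (Digraph [set: 'I_p] [set e | e.1 \in P e.2]) k = P k.
  by apply/setP => i; rewrite !inE.
apply/setP => X; apply/stages_atP/imsetP => [[v vk ->]|[x]].
  have vP : dom (restr (P k) v) = P k.
    by rewrite dom_restr (level_dom vk); apply/setIidPl.
  exists (restr (P k) v); first by rewrite inE vP.
  apply/setP => w; rewrite inE cylinderE vP ?Pk //.
  by apply: andb_id2l => wk; rewrite (TP k) // eq_sym.
rewrite inE => /eqP xP ->.
have [|v vk vx] := extend_level d_gt0 (_ : dom x \subset below p k).
  by rewrite xP.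
exists v => //; apply/setP => w; rewrite inE cylinderE ?xP ?Pk //.
by apply: andb_id2l => wk; rewrite (TP k) // -vx xP eq_sym.
Qed.

(** The DAG enters through the stage statements: the domain of their context depends on the level
    alone, and every outcome on that domain occurs. The rules then carry the change of context
    along. *)
Lemma csi_dag_context T G A B S c c' :
  ordered_dag G -> represents_dag T G -> csi T A B S c ->
  dom c' = dom c -> csi T A B S c'.
Proof.
move=> ordG TG cT; elim: cT c' => {A B S c}.
- move=> k X v XT vX c'.
  have vk : v \in level d k by move: XT; rewrite inE => /andP[_ /subsetP]; apply.
  rewrite dom_restr_agreement // => c'E.
  have pk : parents G k \subset below p k.
    by apply/subsetP => i; rewrite !inE => /ordG[].
  have agrE x : x \in outcomes d (parents G k) ->
      agreement k (cylinder k x) =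
      [set i in below p k | (i \in parents G k) || (d i == 1)].
    by rewrite inE => /eqP xE; rewrite agreement_cylinder ?xE.
  have XE : agreement k X = [set i in below p k | (i \in parents G k) || (d i == 1)].
    by move: XT; rewrite TG => /imsetP[x /agrE <- ->].
  (* The stage of a vertex extending [c'] has a stage statement with context exactly [c']. *)
  have [|v' v'k v'c'] := extend_level d_gt0 (_ : dom c' \subset below p k).
    by rewrite c'E agreement_sub.
  have v'P : dom (restr (parents G k) v') = parents G k.
    by rewrite dom_restr (level_dom v'k); apply/setIidPl.
  set x := restr (parents G k) v' in v'P.
  have xP : x \in outcomes d (parents G k) by rewrite inE v'P.
  rewrite -v'c' c'E XE -(agrE x xP); apply: csi_stage.
    by rewrite TG imset_f.
  by rewrite cylinderE v'P // v'k /=.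
- by move=> A B S c _ IH c' c'c; apply: csi_symmetry; apply: IH.
- move=> A B D S c dis _ IH c' c'c.
  by apply: (@csi_decomposition _ _ _ _ _ D); rewrite ?c'c //; apply: IH.
- move=> A B D S c dis _ IH c' c'c.
  by apply: csi_weak_union; rewrite ?c'c //; apply: IH.
- move=> A B D S c dis _ IH1 _ IH2 c' c'c.
  by apply: csi_contraction; rewrite ?c'c //; [apply: IH1|apply: IH2].
- move=> A B D S c dis _ IH1 _ IH2 c' c'c.
  by apply: csi_intersection; rewrite ?c'c //; [apply: IH1|apply: IH2].
- move=> A B S U c x US; rewrite inE => /eqP xU _ IH c' c'cx.
  (* Splitting [c'] along [dom c] and [U] lets specialization be replayed. *)
  have -> : c' = join (restr (dom c) c') (restr U c').
    apply/ffunP => i; rewrite joinE !restrE.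
    have /setP /(_ i) := c'cx; rewrite dom_join xU in_setU in_dom.
    by case: (c' i) => [a|] /=; case: (i \in dom c); case: (i \in U).
  apply: csi_specialization => //.
    rewrite inE dom_restr c'cx dom_join xU; apply/eqP/setIidPl; exact: subsetUr.
  apply: IH; rewrite dom_restr c'cx dom_join; apply/setIidPl; exact: subsetUl.
- move=> A B S U c dis _ IH c' c'c; apply: csi_absorption; rewrite ?c'c // => x xU.
  by apply: IH xU _ _; rewrite !dom_join c'c.
Qed.

(* A nonempty context can be absorbed, since a DAG treats all its values alike. *)
Lemma dag_minimal_context T c :
  dag_representation T -> minimal_context T c -> dom c = set0.
Proof.
case=> G [_ ordG TG] [A [B [S [_ _ ABc min]]]].
(* Minimality is contradicted by absorbing the whole context, [U := dom c]. *)
apply/eqP; apply: contraT => c0; case: (min (dom c) c0 (subxx _)).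
have rc : dom (restr (~: dom c) c) = set0 by rewrite dom_restr setIC setICr.
apply: csi_absorption => [|x].
  have /pairwise_disjointP H := csi_disjoint ABc.
  apply/pairwise_disjointP => i; move: (H i); rewrite rc /= in_set0.
  by do 4 case: (_ \in _).
rewrite inE => /eqP xc; apply: (csi_dag_context ordG TG ABc).
by rewrite dom_join rc xc set0U.
Qed.

End CStrees.

(** * Trees with context-specific stages *)

Lemma other_value p (d : 'I_p -> nat) (k : nat) (i : 'I_p) (v : outcome d) :
  v \in level d k -> i \in below p k -> 1 < d i ->
  exists w, [/\ w \in level d k, w i != v i & forall l, l != i -> w l = v l].
Proof.
move=> vk ik di.
have [j vj] : exists j : 'I_(d i), Some j != v i.
  case: (v i) => [a|]; last by exists (Ordinal di).
  case: (eqVneq a (Ordinal di)) => [->|a1].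
    by exists (Ordinal (ltnW di)); apply/eqP => -[].
  by exists (Ordinal di); rewrite eq_sym; apply: contraNneq a1 => -[->].
have [y] := single_outcome j; rewrite inE => /eqP yi yj.
exists (join y v); split.
- rewrite in_level dom_join yi (level_dom vk); apply/eqP/setUidPr.
  by rewrite sub1set.
- by rewrite joinE yj.
- by move=> l li; rewrite joinE notin_dom // yi inE.
Qed.

Lemma notin_agreement p (d : 'I_p -> nat) k (X : {set outcome d}) (i : 'I_p) :
  i \in below p k -> i \notin agreement k X ->
  exists v w, [/\ v \in X, w \in X & v i != w i].
Proof.
move=> ik; rewrite inE ik /= => /forall_inPn[v vX /forall_inPn[w wX vw]].
by exists v, w.
Qed.

Lemma mem_agreement p (d : 'I_p -> nat) k (X : {set outcome d}) (i : 'I_p) :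
  i \in agreement k X -> forall v w, v \in X -> w \in X -> v i = w i.
Proof.
by rewrite inE => /andP[_ /forall_inP X1] v w /X1 /forall_inP /[apply] /eqP.
Qed.

Lemma set1_neq0 (F : finType) (a : F) : [set a] != set0.
Proof. by apply/set0Pn; exists a; rewrite inE. Qed.

(** * Three variables *)

Lemma ord3P (k : 'I_3) : [\/ k = X1, k = X2 | k = X3].
Proof.
case: k => -[|[|[|//]]] k3; [apply: Or31|apply: Or32|apply: Or33]; exact: val_inj.
Qed.

Lemma below3_1 : below 3 X1 = set0.
Proof. by apply/setP => k; rewrite !inE. Qed.

Lemma below3_2 : below 3 X2 = [set X1].
Proof. by apply/setP => k; case: (ord3P k) => ->; rewrite !inE. Qed.

Lemma below3_3 : below 3 X3 = [set X1; X2].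
Proof. by apply/setP => k; case: (ord3P k) => ->; rewrite !inE. Qed.

(** The default [false] makes the test imply [i \in dom v]. *)
Definition in_ctx (d : 'I_3 -> nat) (i : 'I_3) (I : {set 'I_(d i)})
    (v : outcome d) : bool :=
  if v i is Some j then j \in I else false.

(* The second level is a single stage iff [m]; in the third level the stages
   X_i = j are merged for j in I and the other stages are singletons. *)
Definition mixed (d : 'I_3 -> nat) (T : cstree d) (m : bool) (i : 'I_3)
    (I : {set 'I_(d i)}) : Prop :=
  (forall v w, v \in level d X2 -> w \in level d X2 ->
     same_stage (@theta _ _ T) v w = m || (v == w)) /\
  (forall v w, v \in level d X3 -> w \in level d X3 ->
     same_stage (@theta _ _ T) v w = (v == w) || (v i == w i) && in_ctx I v).

Definition collider : digraph 3 := Digraph [set: 'I_3] [set (X1, X3); (X2, X3)].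

Lemma complete_dag3 :
  complete_dag 3 = Digraph [set: 'I_3] [set (X1, X2); (X1, X3); (X2, X3)].
Proof.
congr Digraph; apply/setP => -[k l]; rewrite !inE.
by case: (ord3P k) => ->; case: (ord3P l) => ->.
Qed.

(** Used to show that the complete DAG is not a minimal I-MAP when the second level is one stage. *)
Lemma collider_eq : collider = remove_edge (complete_dag 3) (X1, X2).
Proof.
congr Digraph; apply/setP => -[k l]; rewrite !inE.
by case: (ord3P k) => ->; case: (ord3P l) => ->.
Qed.

Lemma collider_complete : collider <> complete_dag 3.
Proof.
by move/(congr1 (fun G => (X1, X2) \in eset G)); rewrite !inE.
Qed.

(** Two disjoint nonempty subsets exhaust a pair, so two variables carry a single nontrivial
    statement up to symmetry. *)
Lemma disjoint_sub_pair (x y : 'I_3) (A B S : {set 'I_3}) :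
  A \subset [set x; y] -> B \subset [set x; y] -> S \subset [set x; y] ->
  pairwise_disjoint [:: A; B; S] -> A != set0 -> B != set0 ->
  S = set0 /\ (A = [set x] /\ B = [set y] \/ A = [set y] /\ B = [set x]).
Proof.
move=> /subsetP Axy /subsetP Bxy /subsetP Sxy /pairwise_disjointP dis.
move=> /set0Pn[a aA] /set0Pn[b bB].
have xy l : l \in [set x; y] -> l = x \/ l = y.
  by rewrite !inE => /orP[] /eqP; [left|right].
have dx := dis x; have dy := dis y; rewrite /= in dx dy.
have [aE|aE] := xy _ (Axy _ aA); have [bE|bE] := xy _ (Bxy _ bB); subst a b.
- by rewrite aA bB in dx.
- rewrite aA bB in dx dy; split; [|left; split]; apply/setP => l; rewrite !inE.
  + apply/negP => lS; have [lE|lE] := xy _ (Sxy _ lS); subst l.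
      by rewrite lS in dx; case: (x \in B) dx.
    by rewrite lS in dy; case: (y \in A) dy.
  + apply/idP/eqP => [lA|->//]; have [//|lE] := xy _ (Axy _ lA); subst l.
    by rewrite lA in dy.
  + apply/idP/eqP => [lB|->//]; have [lE|//] := xy _ (Bxy _ lB); subst l.
    by rewrite lB in dx.
- rewrite aA bB in dx dy; split; [|right; split]; apply/setP => l; rewrite !inE.
  + apply/negP => lS; have [lE|lE] := xy _ (Sxy _ lS); subst l.
      by rewrite lS in dx; case: (x \in A) dx.
    by rewrite lS in dy; case: (y \in B) dy.
  + apply/idP/eqP => [lA|->//]; have [lE|//] := xy _ (Axy _ lA); subst l.
    by rewrite lA in dx.
  + apply/idP/eqP => [lB|->//]; have [//|lE] := xy _ (Bxy _ lB); subst l.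
    by rewrite lB in dy.
- by rewrite aA bB in dy.
Qed.

(** * Derivable statements of a mixed tree *)

Section Mixed.
Variables (d : 'I_3 -> nat) (T : cstree d) (m : bool) (i i' : 'I_3).
Variable I : {set 'I_(d i)}.
Hypotheses (d_gt0 : forall l, 0 < d l) (d1_gt1 : 1 < d X1) (di'_gt1 : 1 < d i').
Hypotheses (ii' : below 3 X3 = [set i; i']) (i'i : i' != i).
Hypothesis I_proper : I \proper [set: 'I_(d i)].
Hypothesis Tm : mixed T m I.

(* Up to symmetry, the only statements with nonempty sides in J(T). *)
Let base (A B : {set 'I_3}) (c : outcome d) : Prop :=
  [/\ A = [set X3], B = [set i'], dom c = [set i] & in_ctx I c] \/
  [/\ m, A = [set X2], B = [set X1] & dom c = set0].

Let derivable (A B S : {set 'I_3}) (c : outcome d) : Prop :=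
  [\/ A = set0, B = set0 | S = set0 /\ (base A B c \/ base B A c)].

Let base_singleton A B c : base A B c \/ base B A c ->
  exists a b, A = [set a] /\ B = [set b].
Proof. by case=> -[[-> -> _ _]|[_ -> -> _]]; do 2!eexists. Qed.

(** A singleton side does not split into two nonempty disjoint parts, so decomposition and weak
    union yield nothing new. *)
Let derivable_union (A B D S : {set 'I_3}) c :
  [disjoint B & D] -> derivable A (B :|: D) S c ->
  [\/ A = set0, B = set0 | D = set0 /\ derivable A B S c].
Proof.
move=> dBD [A0|/eqP|[S0 bAB]]; first by apply: Or31.
  by rewrite setU_eq0 => /andP[/eqP B0 _]; apply: Or32.
have [a [b [_ BD]]] := base_singleton bAB.
have := subsetUl B D; rewrite BD subset1 => /orP[/eqP Bb|/eqP]; last by apply: Or32.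
have := subsetUr B D; rewrite BD subset1 => /orP[/eqP Db|/eqP D0].
  by move: dBD; rewrite Bb Db => /pred0P /(_ b); rewrite /= inE eqxx.
by rewrite D0 setU0 in bAB; apply: Or33; split=> //; apply: Or33.
Qed.

Let derivable_S0 A B S c : derivable A B S c -> A != set0 -> B != set0 -> S = set0.
Proof. by case=> [->|->|[-> _]] //; rewrite eqxx. Qed.

Let i_lt2 : i \in below 3 X3. Proof. by rewrite ii' !inE eqxx. Qed.
Let i'_lt2 : i' \in below 3 X3. Proof. by rewrite ii' !inE eqxx orbT. Qed.

(** Induction on the derivation. Empty conditioning sets leave specialization, contraction and
    intersection nothing to combine; the work lies in the stage statements and in absorption. *)
Lemma mixed_csi A B S c : csi T A B S c -> derivable A B S c.
Proof.
have [T1 T2] := Tm.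
elim=> {A B S c} [k X v|A B S c _ H|A B D S c dis _ H|A B D S c dis _ H
    |A B D S c dis _ H1 _ H2|A B D S c dis _ H1 _ H2|A B S U c x US + _ H
    |A B S U c dis _ H].
- move=> /stages_atP[v0 v0k ->].
  have v0X : v0 \in stage T k v0 by rewrite inE v0k same_stage_refl.
  set X0 := stage T k v0 in v0X *.
  case: (ord3P k) => kE vX; subst k.
  + by apply: Or32; rewrite below3_1 set0D.
  + have vk : v \in level d X2 by move: vX; rewrite inE => /andP[].
    rewrite below3_2; have [X1X|X1X] := boolP (X1 \in agreement X2 X0).
      by apply: Or32; apply/eqP; rewrite setD_eq0 sub1set.
    have agr0 : agreement X2 X0 = set0.
      have := agreement_sub X2 X0; rewrite below3_2 subset1.
      by case/orP=> /eqP // X0E; rewrite X0E inE eqxx in X1X.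
    rewrite agr0 setD0; apply: Or33; split=> //; left; right; split=> //.
      (* A stage that does not fix [X1] has two vertices, which forces [m]. *)
      have [|u [w [uX wX]]] := notin_agreement _ X1X; first by rewrite below3_2 inE.
      move: uX wX; rewrite !inE -!in_level => /andP[uk +] /andP[wk].
      by rewrite !T1 //; case: m => // /eqP <- /eqP <-; rewrite eqxx.
    by rewrite dom_restr set0I.
  + have vk : v \in level d X3 by move: vX; rewrite inE => /andP[].
    (* Every third-level stage fixes [i], so at most [i'] remains on the free side. *)
    have v0i w : w \in X0 -> w i = v0 i.
      rewrite inE => /andP[wk]; rewrite T2 //.
      by case/predU1P => [->|/andP[/eqP]].
    have iX : i \in agreement X3 X0.
      apply: contraT => /(notin_agreement i_lt2)[u [w [/v0i -> /v0i ->]]].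
      by rewrite eqxx.
    have := subDset (below 3 X3) (agreement X3 X0) [set i'].
    have -> : below 3 X3 \subset agreement X3 X0 :|: [set i'].
      by rewrite ii' subUset !sub1set !in_setU iX set11 orbT.
    rewrite subset1 => /orP[/eqP BE|/eqP]; last by apply: Or32.
    have i'X : i' \notin agreement X3 X0.
      by have := set11 i'; rewrite -BE in_setD => /andP[].
    rewrite BE; apply: Or33; split=> //; left; left; split=> //.
      rewrite dom_restr_agreement //; apply/eqP.
      rewrite eqEsubset sub1set iX andbT.
      apply/subsetP => l lX; have := subsetP (agreement_sub _ _) _ lX.
      rewrite ii' !inE; case/orP => // /eqP lE.
      by rewrite lE (negbTE i'X) in lX.
    rewrite /in_ctx restrE iX v0i //.
    have [u [w [uX wX uw]]] := notin_agreement i'_lt2 i'X.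
    (* Off the merged lines the stage is a point, which would fix [i'] as well. *)
    have [//|nv0] := boolP (in_ctx I v0).
    have XE x : x \in X0 -> x = v0.
      rewrite inE => /andP[xk]; rewrite T2 // (negbTE nv0) andbF orbF.
      by move/eqP.
    by rewrite (XE u uX) (XE w wX) eqxx in uw.
- case: H => [A0|B0|[S0 H]]; [exact: Or32|exact: Or31|apply: Or33; split=> //].
  by case: H; [right|left].
- have dBD : [disjoint B & D] by case/and4P: dis => _ /and4P[].
  by case: (derivable_union dBD H) => [|//|[]//]; [apply: Or31|apply: Or32].
- have dBD : [disjoint B & D] by case/and4P: dis => _ /and4P[].
  case: (derivable_union dBD H) => [||[-> ?]]; [exact: Or31|exact: Or32|].
  by rewrite setU0.
- have [A0|An0] := eqVneq A set0; first exact: Or31.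
  have [B0|Bn0] := eqVneq B set0; first by rewrite B0 set0U.
  have /eqP := derivable_S0 H1 An0 Bn0.
  rewrite setU_eq0 => /andP[/eqP S0 /eqP D0].
  by move: H1; rewrite D0 !setU0.
- have [A0|An0] := eqVneq A set0; first exact: Or31.
  have [B0|Bn0] := eqVneq B set0; first by move: H2; rewrite B0 !set0U.
  have /eqP := derivable_S0 H1 An0 Bn0.
  rewrite setU_eq0 => /andP[/eqP S0 /eqP D0].
  by move: H1; rewrite S0 !setU0 set0U.
- rewrite inE => /eqP xU; case: H => [||[S0 H]]; [exact: Or31|exact: Or32|].
  have U0 : U = set0 by apply/eqP; rewrite -subset0 -S0.
  rewrite (dom_eq0 (etrans xU U0)) join_no_context S0 set0D.
  by apply: Or33.
- have [A0|An0] := eqVneq A set0; first exact: Or31.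
  have [B0|Bn0] := eqVneq B set0; first exact: Or32.
  have [U0|Un0] := eqVneq U set0.
    have := H (no_context d); rewrite U0 setU0 join_no_context.
    by apply; rewrite inE dom_no_context.
  (* The premises have a nonempty context, so each of them is a line statement. *)
  have HU x : x \in outcomes d U ->
      [/\ dom c :|: U = [set i] & in_ctx I (join c x)].
    move=> xU; have xUE := xU; rewrite inE in xUE; case: (H x xU).
    + by move/eqP; rewrite (negbTE An0).
    + by move/eqP; rewrite (negbTE Bn0).
    by rewrite /base dom_join (eqP xUE) => -[_ [] [[] //|[_ _ _ /eqP]]];
      rewrite setU_eq0 (negbTE Un0) andbF.
  have [x0 /HU[cUi _]] := outcomes_nonempty d_gt0 U.
  have Ui : U = [set i].
    have := subsetUr (dom c) U; rewrite cUi subset1.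
    by case/orP => /eqP // U0; rewrite U0 eqxx in Un0.
  have ci : c i = None.
    have /pairwise_disjointP /(_ i) := dis; rewrite Ui /= in_set1 eqxx in_dom.
    by case: (c i) => // ?; do 3 case: (_ \in _).
  (* At a value [j] outside [I] the premise of the absorption is not derivable. *)
  case/properP: I_proper => _ [j _ /negP[]].
  have [y] := single_outcome j; rewrite -Ui => /HU[_].
  by rewrite /in_ctx joinE ci => + yj; rewrite yj.
Qed.

(** The stage along a merged line fixes [i] and, since [i'] takes two values, nothing else; this is
    its stage statement. *)
Lemma mixed_csi_line c : dom c = [set i] -> in_ctx I c ->
  csi T [set X3] [set i'] set0 c.
Proof.
move=> ci cI; have [_ T2] := Tm.
have [|v vk vc] := extend_level d_gt0 (_ : dom c \subset below 3 X3).
  by rewrite ci sub1set.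
have vi : v i = c i by rewrite -vc restrE ci set11.
have vI : in_ctx I v by rewrite /in_ctx vi.
have agr : agreement X3 (stage T X3 v) = [set i].
  apply/setP => l; rewrite in_set1; apply/idP/eqP => [lX|->].
    have := subsetP (agreement_sub _ _) _ lX.
    rewrite ii' !inE => /orP[/eqP //|/eqP lE]; subst l.
    have [w [wk wi' wv]] := other_value vk i'_lt2 di'_gt1.
    case/eqP: wi'; apply: (mem_agreement lX).
      by rewrite inE wk T2 // vI wv 1?eq_sym // eqxx orbT.
    by rewrite inE vk same_stage_refl.
  apply: contraT => /(notin_agreement i_lt2)[u [w []]].
  rewrite !inE -!in_level => /andP[uk]; rewrite T2 // => Hu /andP[wk].
  rewrite T2 // => Hw.
  have -> : u i = v i by case/predU1P: Hu => [->|/andP[/eqP]].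
  by case/predU1P: Hw => [->|/andP[/eqP ->]]; rewrite eqxx.
have BE : [set i'] = below 3 X3 :\: [set i].
  by rewrite ii' setU1K // inE eq_sym.
have cE : c = restr (agreement X3 (stage T X3 v)) v by rewrite agr -ci vc.
rewrite BE -[in below 3 X3 :\: _]agr [c]cE; apply: csi_stage.
  by apply/stages_atP; exists v.
by rewrite inE vk same_stage_refl.
Qed.

(** Two values of [X1] in a single second-level stage leave no agreement, so the stage statement has
    an empty context. *)
Lemma mixed_csi_12 : m -> csi T [set X2] [set X1] set0 (no_context d).
Proof.
move=> mT; have [T1 _] := Tm.
have [v vk] := outcomes_nonempty d_gt0 (below 3 X2).
have agr : agreement X2 (stage T X2 v) = set0.
  have := agreement_sub X2 (stage T X2 v); rewrite below3_2 subset1.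
  case/orP=> /eqP // aE.
  have X1a : X1 \in agreement X2 (stage T X2 v) by rewrite aE set11.
  have X1_lt1 : X1 \in below 3 X2 by rewrite inE.
  have [w [wk wv _]] := other_value vk X1_lt1 d1_gt1.
  by case/eqP: wv; apply: (mem_agreement X1a); rewrite inE ?wk ?vk T1 // mT.
have -> : no_context d = restr (agreement X2 (stage T X2 v)) v.
  by apply/esym/dom_eq0; rewrite dom_restr agr set0I.
have -> : [set X1] = below 3 X2 :\: agreement X2 (stage T X2 v).
  by rewrite agr setD0 below3_2.
apply: csi_stage; first by apply/stages_atP; exists v.
by rewrite inE vk same_stage_refl.
Qed.

(** * Minimal contexts of a mixed tree and their DAGs *)

(** Derivable statements with nonempty sides have an empty conditioning set, so no part of the
    context can be absorbed. *)
Lemma mixed_minimal c : dom c != set0 ->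
  minimal_context T c <-> dom c = [set i] /\ in_ctx I c.
Proof.
move=> cn0; split=> [[A [B [S [An0 Bn0 /mixed_csi + _]]]]|[ci cI]].
  case=> [/eqP|/eqP|[_ H]]; rewrite ?(negbTE An0) ?(negbTE Bn0) //.
  by case: H => -[[]|[_ _ _ /eqP]] //; rewrite (negbTE cn0).
exists [set X3], [set i'], set0; split.
- exact: set1_neq0.
- exact: set1_neq0.
- exact: mixed_csi_line.
move=> U Un0 _ /mixed_csi /derivable_S0 /(_ (set1_neq0 _) (set1_neq0 _)) /eqP.
by rewrite set0U (negbTE Un0).
Qed.

(** The empty context has nothing to absorb, so only the existence of a nontrivial CI statement
    matters. *)
Lemma mixed_minimal0 : minimal_context T (no_context d) <-> m.
Proof.
split=> [[A [B [S [An0 Bn0 /mixed_csi + _]]]]|mT].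
  case=> [/eqP|/eqP|[_ H]]; rewrite ?(negbTE An0) ?(negbTE Bn0) //.
  rewrite /base dom_no_context in H.
  by case: H => -[[_ _ /setP /(_ i)]|[]] //; rewrite !inE eqxx.
exists [set X2], [set X1], set0; split; rewrite ?set1_neq0 //.
  exact: mixed_csi_12.
move=> U Un0; rewrite dom_no_context subset0 (negbTE Un0) //.
Qed.

Let ii'P : (i = X1 /\ i' = X2) \/ (i = X2 /\ i' = X1).
Proof.
move: i_lt2 i'_lt2 i'i; rewrite below3_3.
by case: (ord3P i) => ->; case: (ord3P i') => ->; rewrite ?inE //; auto.
Qed.

(** On two vertices the edgeless DAG asserts only the line statement, and it has no edge to
    remove. *)
Lemma mixed_line_dag c : dom c = [set i] -> in_ctx I c ->
  minimal_context_dag T c (Digraph (~: [set i]) set0).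
Proof.
move=> ci cI; split=> /=; first by rewrite ci.
  by move=> k l; rewrite inE.
split=> [A B S /=|e]; last by rewrite inE.
have -> : ~: [set i] = [set X3; i'].
  apply/setP => l; case: ii'P => -[-> ->];
  by case: (ord3P l) => ->; rewrite !inE.
move=> AV BV SV dis An0 Bn0 _.
have [S0 AB] := disjoint_sub_pair AV BV SV dis An0 Bn0.
have VE : [set X3; i'] = ~: dom c.
  rewrite ci; apply/setP => l; case: ii'P => -[-> ->];
  by case: (ord3P l) => ->; rewrite !inE.
split; rewrite -?VE // S0; have := mixed_csi_line ci cI.
by case: AB => -[-> ->] // /csi_symmetry.
Qed.

(** Separated sets are nonadjacent, hence avoid [X3], and [X3] in [S] would open the collider. What
    remains is the independence of [X1] and [X2]. *)
Lemma mixed_imap_collider : m -> imap (context_ci T (no_context d)) collider.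
Proof.
move=> mT A B S _ _ _ dis An0 Bn0 sep.
have dAB : [disjoint A & B] by case/and3P: dis => /and3P[].
(* A one-edge path has no inner vertex to block it. *)
have nadj a b : a \in A -> b \in B -> ~~ adjacent collider a b.
  move=> aA bB; apply/negP => ab; have := sep a b [:: b] aA bB.
  rewrite /= ab inE !andbT => /(_ isT) H; suff ab' : a != b by move: (H ab' erefl).
  by apply: contraL bB => /eqP <-; rewrite (disjointFr dAB aA).
have no3 (D E : {set 'I_3}) : [disjoint D & E] ->
    (forall a b, a \in D -> b \in E -> ~~ adjacent collider a b) ->
    E != set0 -> D \subset [set X1; X2].
  move=> dDE DE /set0Pn[b bE]; apply/subsetP => a aD; move: (DE a b aD bE).
  case: (ord3P a) aD => -> aD; rewrite ?inE //.
  case: (ord3P b) bE => -> bE; rewrite /adjacent ?inE //.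
  by rewrite (disjointFr dDE aD) in bE.
have AV := no3 A B dAB nadj Bn0.
have BV : B \subset [set X1; X2].
  apply: (no3 B A) => //; first by rewrite disjoint_sym.
  by move=> b a bB aA; move: (nadj a b aA bB); rewrite /adjacent orbC.
have SV : S \subset [set X1; X2].
  apply/subsetP => l lS; case: (ord3P l) lS => -> X3S; rewrite ?inE //.
  case/set0Pn: An0 => a aA; case/set0Pn: Bn0 => b bB.
  have := sep a b [:: X3; b] aA bB.
  have ab : a != b by apply: contraL bB => /eqP <-; rewrite (disjointFr dAB aA).
  (* [X3] is its own descendant, so conditioning on it opens the path from [a] to [b] through it. *)
  have X3_open : [exists w in S, descendant collider X3 w].
    by apply/exists_inP; exists X3 => //; apply: connect0.
  have := subsetP AV _ aA; have := subsetP BV _ bB.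
  rewrite !inE => /orP[] /eqP bE /orP[] /eqP aE; subst a b => //;
  by rewrite /= /adjacent /open_at !inE X3_open /= => /(_ isT isT erefl).
have [S0 AB] := disjoint_sub_pair AV BV SV dis An0 Bn0.
split; rewrite ?dom_no_context ?setC0 ?subsetT // S0.
by have := mixed_csi_12 mT; case: AB => -[-> ->] // /csi_symmetry.
Qed.

(** Removing the edge from [a] to [X3] isolates [a], but independence of [a] and [X3] is not
    derivable in the empty context. *)
Lemma mixed_minimal_imap_collider :
  m -> minimal_context_dag T (no_context d) collider.
Proof.
move=> mT; split; first by rewrite dom_no_context setC0.
  by move=> k l; rewrite !inE => /orP[] /eqP[-> ->].
split; first exact: mixed_imap_collider.
move=> e eG H.
have [a e1 aX3] : exists2 a, e = (a, X3) & a != X3.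
  by move: eG; rewrite !inE => /orP[] /eqP ->; eexists.
have isolated l : ~~ adjacent (remove_edge collider e) a l.
  rewrite /adjacent e1 !inE; case: (ord3P a) aX3 => -> //;
  by case: (ord3P l) => ->.
have [] := H [set a] [set X3] set0 (subsetT _) (subsetT _) (subsetT _).
- apply/pairwise_disjointP => l; rewrite /= !inE.
  by case: (eqVneq l a) => [->|_]; [rewrite (negbTE aX3)|case: (l == X3)].
- exact: set1_neq0.
- exact: set1_neq0.
- move=> a' b' s; rewrite !inE => /eqP -> /eqP ->.
  case: s => [_ _ /= E|y s /= /andP[]]; first by rewrite E eqxx in aX3.
  by rewrite (negbTE (isolated y)).
move=> _ _ _ /mixed_csi; case=> [/eqP|/eqP|[_]].
- by rewrite (negbTE (set1_neq0 _)).
- by rewrite (negbTE (set1_neq0 _)).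
rewrite /base dom_no_context; case=> -[[_ _ /setP /(_ i)]|[_ /set1_inj E1 /set1_inj E2 _]].
- by rewrite !inE eqxx.
- by [].
- by rewrite !inE eqxx.
- by [].
Qed.

(** If [m] fails, the empty context is not minimal and the convention supplies the complete DAG. *)
Lemma mixed_is_corresponding :
  is_corresponding T (if m then collider else complete_dag 3)
    (Digraph (~: [set i]) set0) I.
Proof.
split.
- split=> H; last by case: ifP => // /mixed_minimal0.
  by move/mixed_minimal0: H => mT; rewrite mT; apply: mixed_minimal_imap_collider.
- move=> c cn0; apply: iff_trans (mixed_minimal cn0) _.
  split=> [[ci]|[j jI [+ cj]]].
    rewrite /in_ctx; case cj: (c i) => [j|//] jI; exists j => //.
    by rewrite inE ci eqxx.
  by rewrite inE => /eqP ci; rewrite /in_ctx cj.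
- move=> c j jI; rewrite inE => /eqP ci cj; apply: mixed_line_dag => //.
  by rewrite /in_ctx cj.
Qed.

(** Under [m] the complete DAG is not minimal, as deleting the edge from [X1] to [X2] leaves an
    I-MAP; otherwise the convention forces it. *)
Lemma mixed_collider G1 : empty_context_dag T G1 ->
  G1 = complete_dag 3 \/ G1 = collider -> m <-> G1 = collider.
Proof.
case=> min nmin G1E; split=> [mT|G1c].
  have [_ _ [_ G1min]] := min (mixed_minimal0.2 mT).
  case: G1E => // G1E; case: (G1min (X1, X2)); rewrite G1E ?inE //.
  by rewrite -collider_eq; apply: mixed_imap_collider.
apply/idP; apply: contraT => /negP mF; case: collider_complete.
by rewrite -G1c; apply: nmin => /mixed_minimal0.
Qed.

(** The minimal contexts determine [i] and [I], and the empty context DAG determines [m]. *)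
Lemma is_corresponding_mixed G1 G2 i1 (I1 : {set 'I_(d i1)}) :
  family_choice G1 G2 I1 -> is_corresponding T G1 G2 I1 ->
  (m <-> G1 = collider) /\ mixed T m I1.
Proof.
case=> G1E _ _ [I1n0 _] [G1c ctx _]; split.
  by apply: mixed_collider => //; rewrite complete_dag3.
have ctxE c : dom c != set0 ->
    (exists2 j, j \in I1 & c \in outcomes d [set i1] /\ c i1 = Some j) <->
    dom c = [set i] /\ in_ctx I c.
  by move=> cn0; apply: iff_trans (iff_sym (ctx c cn0)) (mixed_minimal cn0).
have ii1 : i = i1.
  have /set0Pn[j jI] := I1n0; have [c ci cj] := single_outcome j.
  have cE : dom c = [set i1] by apply/eqP; rewrite inE in ci.
  have cn0 : dom c != set0 by rewrite cE set1_neq0.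
  have [|+ _] := (ctxE c cn0).1; first by exists j.
  by rewrite cE => /set1_inj.
subst i1; suff -> : I1 = I by [].
apply/setP => j; have [c ci cj] := single_outcome j.
have cE : dom c = [set i] by apply/eqP; rewrite inE in ci.
have cn0 : dom c != set0 by rewrite cE set1_neq0.
have := ctxE c cn0; rewrite /in_ctx cj => -[H1 H2]; apply/idP/idP => jI.
  by case: H1 => //; exists j.
by case: H2 => // j' j'I [_ [->]].
Qed.

End Mixed.

Lemma mixed_eq (d : 'I_3 -> nat) (T T' : cstree d) m i (I : {set 'I_(d i)}) :
  mixed T m I -> mixed T' m I -> cstree_eq T T'.
Proof.
move=> [T1 T2] [T1' T2']; apply: cstree_eq_levelwise => k v w.
case: (ord3P k) => -> vk wk; [|by rewrite T1 ?T1'|by rewrite T2 ?T2'].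
(* The remaining level holds only the root. *)
suff -> : w = v by rewrite !same_stage_refl.
have root u : u \in level d X1 -> u = no_context d.
  by move/level_dom; rewrite below3_1 => /dom_eq0.
by rewrite (root v vk) (root w wk).
Qed.

(** * Classification of the trees *)

Lemma ord_neq_gt1 n (a b : 'I_n) : a != b -> 1 < n.
Proof.
case: n a b => [[]|[a b|]] // => /eqP; case.
by apply: val_inj; case: a b => -[|a] // ? [[|b]].
Qed.

Lemma stage_eqrel p (d : 'I_p -> nat) (T : cstree d) (k : 'I_p) :
  {in level d k & &, equivalence_rel (same_stage (@theta _ _ T))}.
Proof.
move=> u v w uk vk wk; rewrite same_stage_refl; split=> //.
by rewrite !(same_stageE _ uk vk, same_stageE _ uk wk, same_stageE _ vk wk) => /eqP ->.
Qed.

Lemma stage_sym p (d : 'I_p -> nat) (T : cstree d) (k : 'I_p) v w :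
  v \in level d k -> w \in level d k ->
  same_stage (@theta _ _ T) v w = same_stage (@theta _ _ T) w v.
Proof. by move=> vk wk; rewrite !(same_stageE _ vk wk, same_stageE _ wk vk) eq_sym. Qed.

(** A context inside [{X1}] is full or empty, and one empty context already makes the whole level a
    single stage. *)
Lemma level2_stages (d : 'I_3 -> nat) (T : cstree d) :
  exists m : bool, forall v w, v \in level d X2 -> w \in level d X2 ->
    same_stage (@theta _ _ T) v w = m || (v == w).
Proof.
have [/forall_inP all|/forall_inPn[v0 v0k /forall_inPn[w0 w0k /negP n0]]] :=
  boolP [forall v in level d X2, forall w in level d X2,
           same_stage (@theta _ _ T) v w].
  by exists true => v w /all /forall_inP /[apply].
exists false => v w vk wk; have [C Ck vC] := stage_context T vk; rewrite /= vC //.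
move: Ck; rewrite below3_2 subset1 => /orP[] /eqP CE; subst C.
  by rewrite !restr_dom ?(level_dom vk, level_dom wk) ?below3_2.
case: n0; have [_ <-] := stage_eqrel T vk v0k w0k; rewrite vC //;
by apply/restr_eqP => l; rewrite inE.
Qed.

(** The two lower levels always admit uniform parent sets, so only the third can obstruct a DAG. *)
Lemma dag_of_level3 (d : 'I_3 -> nat) (T : cstree d) (P : {set 'I_3}) :
  (forall l, 0 < d l) -> P \subset below 3 X3 ->
  (forall v w, v \in level d X3 -> w \in level d X3 ->
     same_stage (@theta _ _ T) v w = (restr P v == restr P w)) ->
  dag_representation T.
Proof.
move=> d_gt0 P3 TP; apply: dag_of_parents => // k.
case: (ord3P k) => ->; last by exists P.
  exists set0 => [|v w vk wk]; first exact: sub0set.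
  have [C] := stage_context T vk; rewrite below3_1 subset0 => /eqP -> -> //.
have [m T1] := level2_stages T; exists (if m then set0 else below 3 X2).
  by case: m {T1}; rewrite ?sub0set.
move=> v w vk wk; rewrite T1 //; case: m {T1} => /=.
  by apply/esym/restr_eqP => l; rewrite inE.
by rewrite !restr_dom ?(level_dom vk, level_dom wk).
Qed.

(** Some third-level stage is a proper line, say in direction [X_i = j]. Every other stage must then
    fix [i] too, as a crossing line would merge with it into the whole grid. [I] collects the merged
    lines. *)
Lemma not_dag_mixed (d : 'I_3 -> nat) (T : cstree d) :
  (forall l, 0 < d l) -> ~ dag_representation T ->
  exists m i i' (I : {set 'I_(d i)}),
    [/\ below 3 X3 = [set i; i'] /\ i' != i, 1 < d X1, 1 < d X2,
        I != set0 /\ I \proper [set: 'I_(d i)] & mixed T m I].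
Proof.
move=> d_gt0 nD.
have [m T1] := level2_stages T; exists m.
(* A stage filling the level would give the DAG in which [X3] has no parents. *)
have nall v : v \in level d X3 ->
    ~ (forall w, w \in level d X3 -> same_stage (@theta _ _ T) v w).
  move=> vk all; apply: nD; apply: (@dag_of_level3 _ _ set0) => //.
    exact: sub0set.
  move=> u w uk wk; have [_ <-] := stage_eqrel T vk uk wk; last exact: all.
  by rewrite all //; apply/esym/restr_eqP => l; rewrite inE.
(* Without two equivalent vertices the tree is that of a DAG where [X3] has both parents. *)
have [v0 [w0 [v0k w0k vw0 same0]]] : exists v0 w0, [/\ v0 \in level d X3,
    w0 \in level d X3, v0 != w0 & same_stage (@theta _ _ T) v0 w0].
  have [/exists_inP[v vk /exists_inP[w wk /andP[vw s]]]|none] := boolP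
    [exists v in level d X3, exists w in level d X3,
       (v != w) && same_stage (@theta _ _ T) v w]; first by exists v, w.
  case: nD; apply: (@dag_of_level3 _ _ (below 3 X3)) => // v w vk wk.
  rewrite !restr_dom ?(level_dom vk, level_dom wk) //.
  case: (eqVneq v w) => [->|vw]; first exact: same_stage_refl.
  apply: contraNF none => s; apply/exists_inP; exists v => //.
  by apply/exists_inP; exists w => //; rewrite vw.
have [C C3 v0C] := stage_context T v0k.
have [i [i' [ii' i'i CE]]] : exists i i',
    [/\ below 3 X3 = [set i; i'], i' != i & C = [set i]].
  case: (boolP (X1 \in C)) => X1C; case: (boolP (X2 \in C)) => X2C.
  - have CE : C = below 3 X3.
      by apply/eqP; rewrite eqEsubset C3 below3_3 subUset !sub1set X1C.
    move: same0; rewrite v0C // CE !restr_dom ?(level_dom v0k, level_dom w0k) //.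
    by rewrite (negbTE vw0).
  - exists X1, X2; split; rewrite ?below3_3 //; apply/setP => l.
    case: (ord3P l) => ->; rewrite !inE ?X1C ?(negbTE X2C) //.
    by apply/negP => /(subsetP C3); rewrite inE.
  - exists X2, X1; split; rewrite ?below3_3 1?setUC //; apply/setP => l.
    case: (ord3P l) => ->; rewrite !inE ?X2C ?(negbTE X1C) //.
    by apply/negP => /(subsetP C3); rewrite inE.
  - case: (nall v0 v0k) => w wk; rewrite v0C //; apply/restr_eqP => l lC.
    have := subsetP C3 _ lC; rewrite below3_3 !inE => /orP[] /eqP lE; subst l.
      by rewrite lC in X1C.
    by rewrite lC in X2C.
subst C.
have i3 : i \in below 3 X3 by rewrite ii' !inE eqxx.
have i'3 : i' \in below 3 X3 by rewrite ii' !inE eqxx orbT.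
have ext u v : u \in level d X3 -> v \in level d X3 ->
    u i = v i -> u i' = v i' -> u = v.
  move=> uk vk ui ui'; apply: outcome_eqP (level_dom uk) (level_dom vk) _ => l.
  by rewrite ii' !inE => /orP[] /eqP ->.
have v0i w : w \in level d X3 -> same_stage (@theta _ _ T) v0 w = (v0 i == w i).
  move=> wk; rewrite v0C //; apply/restr_eqP/eqP => [|E l]; last by rewrite inE => /eqP ->.
  by apply; rewrite inE.
have vw0i : v0 i = w0 i by apply/eqP; rewrite -v0i.
have key v : v \in level d X3 -> exists2 Cv : {set 'I_3}, i \in Cv &
    forall w, w \in level d X3 -> same_stage (@theta _ _ T) v w = (restr Cv v == restr Cv w).
  move=> vk; have [Cv Cv3 vCv] := stage_context T vk; exists Cv => //.
  apply: contraT => iCv.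
  have same_i' w : w \in level d X3 -> v i' = w i' -> same_stage (@theta _ _ T) v w.
    move=> wk E; rewrite vCv //; apply/restr_eqP => l lC.
    have := subsetP Cv3 _ lC; rewrite ii' !inE => /orP[] /eqP lE; subst l => //.
    by rewrite lC in iCv.
  (* [t] lies in the line X_i through [v0] and in the line X_i' through [v] *)
  pose t := join (restr [set i] v0) v.
  have ti : t i = v0 i.
    rewrite joinE restrE set11; have := i3.
    by rewrite -(level_dom v0k) in_dom; case: (v0 i).
  have ti' : t i' = v i' by rewrite joinE restrE inE (negbTE i'i).
  have tk : t \in level d X3.
    rewrite in_level dom_join dom_restr (level_dom vk) (level_dom v0k).
    by apply/eqP/setUidPr; apply: subsetIr.
  have same_vt : same_stage (@theta _ _ T) v t by apply: same_i'.
  have same_v0t : same_stage (@theta _ _ T) v0 t by rewrite v0i // ti.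
  have same_vv0 : same_stage (@theta _ _ T) v v0.
    by rewrite (stage_sym T vk v0k); have [_ ->] := stage_eqrel T v0k tk vk;
       rewrite // (stage_sym T tk vk).
  have same_vw0 : same_stage (@theta _ _ T) v w0.
    by have [_ ->] := stage_eqrel T vk v0k w0k.
  (* If [i'] is fixed, [v0] and [w0] agree on both coordinates; if not, the stage of [v] fills the
     level. *)
  have [i'Cv|i'Cv] := boolP (i' \in Cv).
    move: same_vv0 same_vw0; rewrite !vCv //.
    move=> /restr_eqP /(_ _ i'Cv) E1 /restr_eqP /(_ _ i'Cv) E2.
    by rewrite (ext v0 w0) ?eqxx // -?E1 in vw0.
  case: (nall v vk) => w wk; rewrite vCv //; apply/restr_eqP => l lC.
  have := subsetP Cv3 _ lC; rewrite ii' !inE => /orP[] /eqP lE; subst l.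
    by rewrite lC in iCv.
  by rewrite lC in i'Cv.
have same_i v w : v \in level d X3 -> w \in level d X3 ->
    same_stage (@theta _ _ T) v w -> v i = w i.
  by move=> vk wk; have [Cv iCv ->] := key v vk => // /restr_eqP /(_ _ iCv).
(* Distinct equivalent vertices agree at [i], hence differ at [i']: their stage is the full line. *)
have line v w u : v \in level d X3 -> w \in level d X3 -> u \in level d X3 ->
    v != w -> same_stage (@theta _ _ T) v w -> v i = u i ->
    same_stage (@theta _ _ T) v u.
  move=> vk wk uk vw svw vu; have [Cv iCv vCv] := key v vk.
  move: (svw); rewrite !vCv // => /restr_eqP E; apply/restr_eqP => l lCv.
  have [->//|li] := eqVneq l i.
  have [lE|li'] := eqVneq l i'.
    by rewrite (ext v w) ?eqxx // in vw; apply: E; rewrite -?lE.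
  have ln : l \notin below 3 X3 by rewrite ii' !inE (negbTE li).
  by rewrite !notin_dom ?(level_dom vk) ?(level_dom uk).
pose I := [set j : 'I_(d i) | [exists v in level d X3, exists w in level d X3,
  [&& v i == Some j, v != w & same_stage (@theta _ _ T) v w]]].
have T2 v w : v \in level d X3 -> w \in level d X3 ->
    same_stage (@theta _ _ T) v w = (v == w) || (v i == w i) && in_ctx I v.
  move=> vk wk; have [->|vw] := eqVneq v w; first exact: same_stage_refl.
  have vis : isSome (v i) by rewrite -in_dom (level_dom vk).
  apply/idP/andP => [s|[/eqP vwi]].
    rewrite (same_i v w) //; split=> //; rewrite /in_ctx.
    case vj: (v i) vis => [j|//] _; rewrite inE; apply/exists_inP; exists v => //.
    by apply/exists_inP; exists w => //; rewrite vj eqxx vw.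
  rewrite /in_ctx; case vj: (v i) => [j|//].
  rewrite inE => /exists_inP[v1 v1k /exists_inP[w1 w1k /and3P[/eqP v1j vw1 s1]]].
  have sv := line _ _ _ v1k w1k vk vw1 s1 (etrans v1j (esym vj)).
  have sw := line _ _ _ v1k w1k wk vw1 s1 (etrans v1j (esym (etrans (esym vwi) vj))).
  by have [_ <-] := stage_eqrel T v1k vk wk.
have [j v0j] : exists j, v0 i = Some j.
  have : isSome (v0 i) by rewrite -in_dom (level_dom v0k).
  by case: (v0 i) => [j|//]; exists j.
have jI : j \in I.
  by rewrite inE; apply/exists_inP; exists v0 => //; apply/exists_inP; exists w0;
     rewrite // v0j eqxx vw0.
(* If all lines were merged, [i] would be the only parent of [X3]. *)
have IT : I != [set: 'I_(d i)].
  apply/eqP => IE; apply: nD; apply: (@dag_of_level3 _ _ [set i]) => //.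
  move=> v w vk wk; rewrite T2 //.
  have -> : in_ctx I v.
    have : isSome (v i) by rewrite -in_dom (level_dom vk).
    by rewrite /in_ctx IE; case: (v i) => // a; rewrite inE.
  rewrite andbT; apply/predU1P/restr_eqP => [[->//|/eqP E] l|E].
    by rewrite inE => /eqP ->.
  by right; apply/eqP/E; rewrite inE.
have [j' j'I] : exists j', j' \notin I.
  have /properP[_ [j' _ j'I]] : I \proper [set: 'I_(d i)] by rewrite properT.
  by exists j'.
have di_gt1 : 1 < d i by apply: (@ord_neq_gt1 _ j j'); apply: contraNneq j'I => <-.
have di'_gt1 : 1 < d i'.
  have : v0 i' != w0 i' by apply: contraNneq vw0 => E; rewrite (ext v0 w0).
  have : isSome (v0 i') by rewrite -in_dom (level_dom v0k).
  have : isSome (w0 i') by rewrite -in_dom (level_dom w0k).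
  by case: (v0 i') (w0 i') => [a|//] [b|//] _ _ ab; apply: (@ord_neq_gt1 _ a b).
exists i, i', I; split=> //.
- move: i3 i'3 i'i di_gt1 di'_gt1; rewrite below3_3.
  by case: (ord3P i) => ->; case: (ord3P i') => ->; rewrite ?inE.
- move: i3 i'3 i'i di_gt1 di'_gt1; rewrite below3_3.
  by case: (ord3P i) => ->; case: (ord3P i') => ->; rewrite ?inE.
- by split; [apply/set0Pn; exists j|rewrite properT].
Qed.

(** * Existence *)

(** With 0-based indices, vertices of level [k] assign the variables before [k], and an edge assigns
    [k] itself. *)
Lemma childrenE p (d : 'I_p -> nat) (k : 'I_p) (v : outcome d) : v \in level d k ->
  children v = [set join v y | y in outcomes d [set k]].
Proof.
move=> vk; apply/setP => w; rewrite inE; apply/existsP/imsetP.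
  move=> [l /and3P[vl wl /eqP wv]].
  have kl : k = l.
    apply/val_inj/(@below_inj p); rewrite ?(ltnW (ltn_ord _)) //.
    by rewrite -(level_dom vk) (level_dom vl).
  subst l; exists (restr [set k] w).
    rewrite inE dom_restr (level_dom wl); apply/eqP/setIidPl.
    by rewrite sub1set inE ltnS.
  apply/ffunP => i; rewrite joinE restrE inE -[in RHS]wv restrE in_below.
  case: ltngtP => [ik|ik|/val_inj ->]; last by rewrite eqxx.
    by case: (w i) => //; case: eqP.
  by rewrite -val_eqE gtn_eqF // notin_dom // (level_dom wl) in_below ltnS -ltnNge.
move=> [y]; rewrite inE => /eqP yk ->; exists k; rewrite vk !in_level /=.
rewrite dom_join yk (level_dom vk); apply/andP; split.
  by apply/eqP/setP => i; rewrite !inE ltnS (leq_eqVlt i k) orbC.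
apply/eqP/ffunP => i; rewrite restrE joinE in_below.
case: ltnP => ik.
  suff yi : y i = None by rewrite yi; case: (v i).
  by rewrite notin_dom // yk inE; apply: contraTneq ik => ->; rewrite ltnn.
by rewrite notin_dom // (level_dom vk) inE -leqNgt.
Qed.

Lemma children_leaf p (d : 'I_p -> nat) (v : outcome d) : leaf v -> children v = set0.
Proof.
move=> vl; apply/setP => w; rewrite !inE; apply/existsP => -[k /and3P[vk _ _]].
by rewrite (level_nleaf vk) in vl.
Qed.

(* [r v] is the context of the stage of [v]; the last hypothesis on [r] makes the
   stage of [v] the whole cylinder. *)
Lemma cstree_of_contexts p (d : 'I_p -> nat) (r : outcome d -> {set 'I_p}) :
  (forall i, 0 < d i) -> (forall v, r v \subset dom v) ->
  (forall v w, dom w = dom v -> restr (r v) w = restr (r v) v -> r w = r v) ->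
  exists T : cstree d, forall (k : 'I_p) v w, v \in level d k -> w \in level d k ->
    same_stage (@theta _ _ T) v w = (restr (r v) v == restr (r w) w).
Proof.
move=> d_gt0 rdom rstop.
pose key v := (restr (r v) v, dom v).
(* The label pairs the stage's key with the new value: [dom v] in the key separates levels, and the
   context values identify the stage. *)
pose th v w : outcome d * {set 'I_p} * outcome d := (key v, restr (~: dom v) w).
have labelsE (k : 'I_p) v : v \in level d k ->
    edge_labels th v = [set (key v, y) | y in outcomes d [set k]].
  move=> vk; rewrite /edge_labels (childrenE vk) -imset_comp.
  apply: eq_in_imset => y; rewrite inE => /eqP yk; congr (_, _).
  apply/ffunP => i; rewrite restrE joinE inE in_dom.
  case vi: (v i) => [a|] //=; rewrite notin_dom // yk inE.
  have ik : i < k by rewrite -in_below -(level_dom vk) in_dom vi.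
  by apply: contraTneq ik => ->; rewrite ltnn.
have labels_leaf v : leaf v -> edge_labels th v = set0.
  by move=> vl; rewrite /edge_labels children_leaf // imset0.
have key_eq (k l : 'I_p) v w : v \in level d k -> w \in level d l ->
    (edge_labels th v == edge_labels th w) = (key v == key w).
  move=> vk wl; rewrite (labelsE k) // (labelsE l) //; apply/eqP/eqP => [E|E].
    have [y yk] := outcomes_nonempty d_gt0 [set k].
    have : (key v, y) \in [set (key v, y) | y in outcomes d [set k]] by apply: imset_f.
    by rewrite E => /imsetP[z _ [rvw dvw _]]; rewrite /key rvw dvw.
  have kl : k = l.
    apply/val_inj/(@below_inj p); rewrite ?(ltnW (ltn_ord _)) //.
    by rewrite -(level_dom vk) -(level_dom wl); case: E.
  by rewrite E kl.
have stageE (k : 'I_p) v w : v \in level d k -> w \in level d k ->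
    same_stage th v w = (restr (r v) v == restr (r w) w).
  move=> vk wk; rewrite (same_stageE _ vk wk) (key_eq k k) //.
  by rewrite /key xpair_eqE (level_dom vk) (level_dom wk) eqxx andbT.
have staged : staged_tree th.
  split=> [v /verticesP[vl|[k vk]]|v w].
  - by rewrite labels_leaf // children_leaf // !cards0.
  - rewrite (labelsE k) // (childrenE vk) !card_in_imset //; last by move=> y z _ _ [].
    move=> y z; rewrite !inE => /eqP yk /eqP zk E; apply: outcome_eqP yk zk _ => i.
    rewrite inE => /eqP ik; have := congr1 (fun x : outcome d => x i) E.
    by rewrite !joinE notin_dom // (level_dom vk) inE ik ltnn.
  - case/verticesP => [vl _|[k vk]].
      by right; rewrite labels_leaf // -setI_eq0 set0I.
    case/verticesP => [wl|[l wl]].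
      by right; rewrite (labels_leaf w) // -setI_eq0 setI0.
    case: (eqVneq (edge_labels th v) (edge_labels th w)) => [|ne]; [by left|right].
    rewrite (key_eq k l) // in ne; rewrite (labelsE k) // (labelsE l) // -setI_eq0.
    (* A shared label exposes the same key on both sides. *)
    apply: contraNT ne => /set0Pn[x]; rewrite inE => /andP[].
    by move=> /imsetP[y _ ->] /imsetP[z _ [rvw dvw _]]; rewrite /key rvw dvw.
have levels (k l : 'I_p) v w : v \in level d k -> w \in level d l -> k != l ->
    edge_labels th v <> edge_labels th w.
  move=> vk wl kl /eqP; rewrite (key_eq k l) // xpair_eqE => /andP[_ /eqP].
  rewrite (level_dom vk) (level_dom wl) => /below_inj E.
  by case/eqP: kl; apply/val_inj/E; apply: ltnW.
have labels (k : 'I_p) v v' w w' : v \in level d k -> v' \in level d k ->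
    same_stage th v v' -> edge v w -> edge v' w' -> w k = w' k -> th v w = th v' w'.
  move=> vk v'k; rewrite (same_stageE _ vk v'k) (key_eq k k) // => /eqP E vw v'w' wk.
  rewrite /th E; congr (_, _); apply/ffunP => i.
  rewrite !restrE (level_dom vk) (level_dom v'k) !inE; case: ltnP => //= ki.
  have child x y : x \in level d k -> edge x y -> k < i -> y i = None.
    move=> xk; have := childrenE xk => /setP /(_ y); rewrite inE => -> /imsetP[z].
    rewrite inE => /eqP zk -> lt_ki; rewrite notin_dom // dom_join zk (level_dom xk).
    by rewrite !inE negb_or -leqNgt ki -val_eqE gtn_eqF.
  case: ltngtP ki => // [ki _|/val_inj <- //].
  by rewrite (child v w) ?(child v' w').
have contexts (k : 'I_p) (X : {set outcome d}) :
    X \in label_stages th -> X \subset level d k ->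
    exists (C : {set 'I_p}) (x : outcome d),
      [/\ C \subset below p k, x \in outcomes d C & X = cylinder k x].
  case/imsetP => v vV -> /subsetP Xk.
  have vk : v \in level d k by apply: Xk; rewrite inE vV same_stage_refl.
  have rk : r v \subset below p k by rewrite -(level_dom vk) rdom.
  have dr : dom (restr (r v) v) = r v by rewrite dom_restr; apply/setIidPl.
  exists (r v), (restr (r v) v); split=> //; first by rewrite inE dr.
  apply/setP => w; rewrite cylinderE dr //; apply/idP/andP => [wX|[wk /eqP vw]].
    have wk := Xk _ wX; split=> //; move: wX; rewrite inE => /andP[_].
    rewrite (stageE k) // => /eqP E; have := congr1 (@dom p d) E.
    rewrite dr dom_restr (setIidPl (rdom w)) => rE.
    by rewrite E rE.
  have kp : k <= p by apply: ltnW.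
  have wv : dom w = dom v by rewrite (level_dom vk) (level_dom wk).
  by rewrite inE (level_vertices kp wk) (stageE k) // (rstop v w wv vw) vw /=.
by exists (CStree staged levels labels contexts).
Qed.

Lemma mixed_exists (d : 'I_3 -> nat) m i (I : {set 'I_(d i)}) :
  (forall l, 0 < d l) -> exists T : cstree d, mixed T m I.
Proof.
move=> d_gt0.
(* On the third level, merged lines keep only [i]; the root, leaves and unmerged points keep their
   full domain. *)
pose r (v : outcome d) : {set 'I_3} :=
  if dom v == below 3 X2 then if m then set0 else dom v
  else if (dom v == below 3 X3) && in_ctx I v then [set i] else dom v.
have ctx_i v : in_ctx I v -> i \in dom v by rewrite /in_ctx in_dom; case: (v i).
have [||T Tr] := @cstree_of_contexts _ d r d_gt0.
- move=> v; rewrite /r; case: ifP => _; first by case: ifP; rewrite ?sub0set.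
  by case: ifP => // /andP[_ /ctx_i]; rewrite sub1set.
- move=> v w vw; rewrite /r vw; case: ifP => // _.
  case: ifP => [/andP[-> vI]|].
    move/(congr1 (fun x : outcome d => x i)); rewrite !restrE set11 => E.
    by rewrite /in_ctx E -/(in_ctx I v) vI.
  case: ifP => // /andP[-> wI] /= vI.
  rewrite !restr_dom ?vw // => E; by rewrite E vI in wI.
have below23 : (below 3 X3 == below 3 X2) = false.
  by apply/eqP => /setP /(_ X2); rewrite !inE.
exists T; split=> v w vk wk; rewrite (Tr _ _ _ vk wk) /r (level_dom vk) (level_dom wk).
  rewrite eqxx; case: (boolP m) => _ /=.
    by apply/restr_eqP => l; rewrite inE.
  by rewrite !restr_dom ?(level_dom vk) ?(level_dom wk).
rewrite below23 eqxx /=.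
have i3 (x : outcome d) : x \in level d X3 -> in_ctx I x -> i \in below 3 X3.
  by move=> xk /ctx_i; rewrite (level_dom xk).
have in_ctxE : v i = w i -> in_ctx I v = in_ctx I w by rewrite /in_ctx => ->.
case vI: (in_ctx I v); case wI: (in_ctx I w).
- rewrite andbT; apply/restr_eqP/predU1P => [E|[->//|/eqP E] l].
    by right; apply/eqP/E; rewrite inE.
  by rewrite inE => /eqP ->.
(* A merged vertex and an unmerged one differ at [i], so their keys differ. *)
- rewrite andbT (_ : (v i == w i) = false) ?orbF; last first.
    by apply/eqP => /in_ctxE; rewrite vI wI.
  rewrite [restr (below _ _) w]restr_dom ?(level_dom wk) //.
  apply/eqP/eqP => [E|E]; last by rewrite E wI in vI.
  by move: wI; rewrite -E /in_ctx restrE set11 -/(in_ctx I v) vI.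
- rewrite andbF orbF [restr (below _ _) v]restr_dom ?(level_dom vk) //.
  apply/eqP/eqP => [E|E]; last by rewrite E wI in vI.
  by move: vI; rewrite E /in_ctx restrE set11 -/(in_ctx I w) wI.
- by rewrite andbF orbF !restr_dom ?(level_dom vk) ?(level_dom wk).
Qed.

(** * The four families *)

(** The index [i] determines [G2], leaving [G1], [i] and [I] as the free data. *)
Lemma family_choice_dag (d : 'I_3 -> nat) G1 G2 (i : 'I_3) (I : {set 'I_(d i)}) :
  family_choice G1 G2 I ->
  [/\ G1 = complete_dag 3 \/ G1 = collider, G2 = Digraph (~: [set i]) set0 &
      exists2 i', below 3 X3 = [set i; i'] & i' != i].
Proof.
case=> G1E G2E [i12 iG2] _; split; first by rewrite complete_dag3.
  case: G2E iG2 i12 => -> /=; rewrite !inE; case: (ord3P i) => -> // _ _;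
  by congr Digraph; apply/setP => l; case: (ord3P l) => ->; rewrite !inE.
by move: i12; rewrite below3_3 !inE => /orP[] /eqP ->;
  [exists X2|exists X1; rewrite // setUC].
Qed.

Lemma gt1_coordinate (d : 'I_3 -> nat) (i i' : 'I_3) :
  1 < d X1 -> 1 < d X2 -> below 3 X3 = [set i; i'] -> 1 < d i'.
Proof.
move=> d1 d2 ii'; have : i' \in [set X1; X2] by rewrite -below3_3 ii' set22.
by rewrite !inE => /orP[] /eqP ->.
Qed.

(** Besides the classification, each choice of data determines at most one tree. Existence asks for
    two values of [X1] and of [X2], which [not_dag_mixed] shows to be necessary. *)
Theorem proposition3p4 (d : 'I_3 -> nat) (d_gt0 : forall i, 0 < d i) :
  (forall T : cstree d,
     ~ dag_representation T <->
     exists (G1 G2 : digraph 3) (i : 'I_3) (I : {set 'I_(d i)}),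
       family_choice G1 G2 I /\ is_corresponding T G1 G2 I) /\
  (forall (G1 G2 : digraph 3) (i : 'I_3) (I : {set 'I_(d i)}),
     family_choice G1 G2 I ->
     (1 < d X1 -> 1 < d X2 ->
      exists T : cstree d, is_corresponding T G1 G2 I) /\
     (forall T T' : cstree d, is_corresponding T G1 G2 I ->
        is_corresponding T' G1 G2 I -> cstree_eq T T')).
Proof.
(* A value in [I] gives a nonempty minimal context, which a DAG does not have. *)
have corr_not_dag (T : cstree d) G1 G2 (i : 'I_3) (I : {set 'I_(d i)}) :
    family_choice G1 G2 I -> is_corresponding T G1 G2 I -> ~ dag_representation T.
  move=> [_ _ _ [/set0Pn[j jI] _]] [_ ctx _] TG.
  have [c ci cj] := single_outcome j.
  have cE : dom c = [set i] by apply/eqP; rewrite inE in ci.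
  have cn0 : dom c != set0 by rewrite cE set1_neq0.
  case/eqP: cn0; apply: (dag_minimal_context d_gt0 TG); apply/ctx.
    by rewrite cE set1_neq0.
  by exists j.
split=> [T|G1 G2 i I fam]; split.
- case/(not_dag_mixed d_gt0) => m [i [i' [I [[ii' i'i] d1 d2 [In0 Ip] Tm]]]].
  have i12 : i \in [set X1; X2] by rewrite -below3_3 ii' !inE eqxx.
  have di' := gt1_coordinate d1 d2 ii'.
  exists (if m then collider else complete_dag 3), (Digraph (~: [set i]) set0), i, I.
  split; last exact: (mixed_is_corresponding d_gt0 d1 di' ii' i'i Ip Tm).
  split=> //.
  + by rewrite complete_dag3; case: m {Tm}; [right|left].
  + by move: i12; rewrite !inE => /orP[] /eqP ->; [right|left];
      congr Digraph; apply/setP => l; case: (ord3P l) => ->; rewrite !inE.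
  + by split; rewrite //= !inE eqxx.
- by case=> G1 [G2 [i [I [fam /(corr_not_dag _ _ _ _ _ fam)]]]].
- move=> d1 d2; have [G1E -> [i' ii' i'i]] := family_choice_dag fam.
  have [_ _ _ [_ Ip]] := fam.
  have di' := gt1_coordinate d1 d2 ii'.
  case: G1E => ->.
    have [T Tm] := mixed_exists false I d_gt0; exists T.
    exact: (mixed_is_corresponding d_gt0 d1 di' ii' i'i Ip Tm).
  have [T Tm] := mixed_exists true I d_gt0; exists T.
  exact: (mixed_is_corresponding d_gt0 d1 di' ii' i'i Ip Tm).
(* A corresponding tree is mixed with parameters read off from [G1], [i] and [I], so any two have
   the same stages. *)
- have mixedT (T : cstree d) : is_corresponding T G1 G2 I ->
      exists2 m : bool, m <-> G1 = collider & mixed T m I.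
    move=> TI; have nD := corr_not_dag _ _ _ _ _ fam TI.
    have [m [i0 [i' [I0 [[ii' i'i] d1 d2 [In0 Ip] Tm]]]]] := not_dag_mixed d_gt0 nD.
    have di' := gt1_coordinate d1 d2 ii'.
    exists m; by have [] := is_corresponding_mixed d_gt0 d1 di' ii' i'i Ip Tm fam TI.
  move=> T T' /mixedT[m mG Tm] /mixedT[m' m'G T'm].
  suff mm' : m = m' by rewrite -mm' in T'm; apply: mixed_eq Tm T'm.
  by apply/idP/idP => [/mG /m'G|/m'G /mG].
Qed.
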